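(* Let $A$ generate a uniformly bounded, strongly stable $C_0$-semigroup $S(t)$ on a Hilbert space $H$. Fix $T>0$, put $\omega_n=2\pi n/T$, and assume $i\omega_n\in\rho(A)$ for all $n\in\mathbb Z$. Assume that $A$ exhibits infinite derivative loss for the period $T$. Then there exists $f\in C^\infty_{\#}(0,T;H)$ such that $\dot u=Au+f$ admits no $T$-periodic mild solution; consequently, $(T,f)$ is a statically, and therefore secularly, resonant pair.
   Context: Strongly stable means $S(t)x\to0$ as $t\to\infty$ for every $x\in H$. The subscript $\#$ denotes spaces of $T$-periodic functions; $H^m_{\#}(0,T;H)$ is the periodic Sobolev space in time ($H^0_\#=L^2_\#$) and $C^\infty_{\#}(0,T;H)$ the smooth $T$-periodic $H$-valued functions. A mild solution of $\dot u=Au+f$ is $u(t)=S(t)u_0+\int_0^tS(t-s)f(s)\,ds$, $t\ge0$, with $u_0\in H$. For integer $m\ge1$, $A$ exhibits $m$-derivative loss for the period $T$ if there does not exist $C_m>0$ with $\|u\|_{L^2(0,T;H)}\le C_m\|f\|_{H^{m-1}_{\#}(0,T;H)}$ for all $f\in H^{m-1}_{\#}(0,T;H)$ admitting a $T$-periodic mild solution $u$. Infinite derivative loss for $T$ means $m$-derivative loss for every $m\ge1$. $(T,f)$ is statically resonant if there is no $T$-periodic mild solution, and secularly resonant if some mild solution satisfies $\sup_{t\ge0}\|u(t)\|_H=\infty$. *)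

(* Defs.v *)
From HB Require Import structures.
From mathcomp Require Import all_boot all_order all_algebra.
From mathcomp Require Export complex.
From mathcomp Require Import all_classical all_reals all_analysis.

Set Implicit Arguments.
Unset Strict Implicit.
Unset Printing Implicit Defensive.

Import Order.TTheory GRing.Theory Num.Theory.
Import numFieldNormedType.Exports.

Local Open Scope classical_set_scope.
Local Open Scope ring_scope.
Local Open Scope complex_scope.

Section NormedSpace.
Context {R : realType} {V : normedModType R[i]}.
Implicit Types (f g u : R -> V) (T t : R) (D : set R).

(* In a normed space over [R[i]] the library norm takes values in [R[i]]; it is
   a nonnegative real number, so its real part carries all the information. *)
Definition rnorm (x : V) : R := complex.Re `|x|.

Definition simple_function (s : R -> V) : Prop :=
  finite_set (range s) /\ forall v, measurable (s @^-1` [set v]).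

(* Only used on bounded intervals, where all the measures are finite. *)
Definition simple_integral D (s : R -> V) : V :=
  \sum_(v \in range s)
    (fine (lebesgue_measure (D `&` s @^-1` [set v])))%:C *: v.

(* Strong (Bochner) measurability with everywhere, rather than almost
   everywhere, convergence: every a.e.-class of strongly measurable functions
   has such a representative, and with this choice the integrands in the
   (Lebesgue) integrals of norms below are Borel. *)
Definition strongly_measurable D f : Prop :=
  exists s : nat -> R -> V, (forall n, simple_function (s n)) /\
    (forall t, D t -> s n t @[n --> \oo] --> f t).

(* [f] is Bochner integrable on the bounded interval [D], with integral [v]. *)
Definition is_bochner_integral D f (v : V) : Prop :=
  exists s : nat -> R -> V,
    [/\ forall n, simple_function (s n),
        forall t, D t -> s n t @[n --> \oo] --> f t,
        (\int[lebesgue_measure]_(t in D) (rnorm (f t - s n t))%:E)%E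
          @[n --> \oo] --> 0%E
      & simple_integral D (s n) @[n --> \oo] --> v].

Definition periodic_fun T f : Prop := forall t, f (t + T) = f t.

(* Derivative with respect to the real variable; the library's [derive] would
   require [V] to be a normed space over the field of the variable. *)
Definition has_deriv f g : Prop :=
  forall t, (h^-1)%:C *: (f (t + h) - f t) @[h --> 0^'] --> g t.

Definition smooth_periodic T f : Prop :=
  periodic_fun T f /\
  exists d : nat -> R -> V,
    d 0%N = f /\ forall n, has_deriv (d n) (d n.+1).

Definition L2norm T f : \bar R :=
  ((\int[lebesgue_measure]_(t in `[0%R, T]) ((rnorm (f t)) ^+ 2)%:E) `^ 2^-1)%E.

Definition L2_periodic T f : Prop :=
  [/\ periodic_fun T f, strongly_measurable setT f & (L2norm T f < +oo)%E].

End NormedSpace.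

Section PeriodicSobolev.
Context {R : realType} {V : normedModType R[i]}.
Implicit Types (f : R -> V) (T : R) (m : nat).

(* Weak derivative on the circle: the test functions are smooth, T-periodic and
   complex-valued, and the integrals over a period satisfy
   int phi' f = - int phi g. *)
Definition weak_deriv T f (g : R -> V) : Prop :=
  forall phi dphi : R -> R[i]^o,
    smooth_periodic T phi -> has_deriv phi dphi ->
    exists v : V,
      is_bochner_integral `[0, T] (fun t => dphi t *: f t) v /\
      is_bochner_integral `[0, T] (fun t => phi t *: g t) (- v).

(* [g k], k <= m, is (a representative of) the k-th weak derivative of [f]. *)
Definition sobolev_derivs m T f (g : nat -> R -> V) : Prop :=
  [/\ g 0%N = f,
      forall k, (k <= m)%N -> L2_periodic T (g k)
    & forall k, (k < m)%N -> weak_deriv T (g k) (g k.+1)].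

Definition sobolev_periodic m T f : Prop := exists g, sobolev_derivs m T f g.

(* The weak derivatives being unique almost everywhere, the infimum ranges over
   a single value when [f] is in the Sobolev space (and is +oo otherwise). *)
Definition sobolev_norm m T f : \bar R :=
  ereal_inf [set ((\sum_(k < m.+1) L2norm T (g k) ^+ 2) `^ 2^-1)%E |
             g in sobolev_derivs m T f].

End PeriodicSobolev.

Section Semigroup.
Context {R : realType} {H : normedModType R[i]}.
Implicit Types (S : R -> {linear H -> H}) (DA : set H) (A : H -> H).
Implicit Types (f u : R -> H) (T : R) (m : nat).

(* The values [S t] for t < 0 are irrelevant everywhere below. *)
Definition C0_semigroup S : Prop :=
  [/\ forall t, 0 <= t -> continuous (S t),
      forall x, S 0 x = x,
      forall s t x, 0 <= s -> 0 <= t -> S (s + t) x = S s (S t x)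
    & forall x, S h x @[h --> 0^'+] --> x].

(* The unbounded operator [A] has domain [DA]; its values outside [DA] are
   irrelevant. *)
Definition generates DA A S : Prop :=
  forall x y, (DA x /\ A x = y) <->
    (h^-1)%:C *: (S h x - x) @[h --> 0^'+] --> y.

Definition uniformly_bounded S : Prop :=
  exists M : R, forall t x, 0 <= t -> rnorm (S t x) <= M * rnorm x.

Definition strongly_stable S : Prop :=
  forall x, S t x @[t --> +oo] --> (0 : H).

Definition resolvent_set DA A : set R[i] :=
  [set l | exists B : {linear H -> H},
     [/\ continuous B,
         forall y, DA (B y) /\ l *: B y - A (B y) = y
       & forall x, DA x -> B (l *: x - A x) = x]].

Definition mild_solution S f u : Prop :=
  exists u0 : H, forall t, 0 <= t ->
    exists v, is_bochner_integral `[0, t] (fun s => S (t - s) (f s)) v /\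
      u t = S t u0 + v.

Definition periodic_mild_solution S T f u : Prop :=
  mild_solution S f u /\ forall t, 0 <= t -> u (t + T) = u t.

Definition derivative_loss S T m : Prop :=
  ~ exists C : R, 0 < C /\
      forall f u, sobolev_periodic m.-1 T f -> periodic_mild_solution S T f u ->
        (L2norm T u <= C%:E * sobolev_norm m.-1 T f)%E.

Definition infinite_derivative_loss S T : Prop :=
  forall m, (1 <= m)%N -> derivative_loss S T m.

Definition statically_resonant S T f : Prop :=
  ~ exists u, periodic_mild_solution S T f u.

Definition secularly_resonant S f : Prop :=
  exists u, mild_solution S f u /\
    ereal_sup [set (rnorm (u t))%:E | t in [set t : R | 0 <= t]] = +oo%E.

End Semigroup.

(* Main.v *)
Require Import Defs.
From mathcomp Require Import all_boot all_order all_algebra.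
From mathcomp Require Import all_classical all_reals all_analysis.
From mathcomp Require Import measurable_realfun.
From mathcomp Require Import ring lra.

Set Implicit Arguments.
Unset Strict Implicit.
Unset Printing Implicit Defensive.

Import Order.TTheory GRing.Theory Num.Theory.
Import numFieldNormedType.Exports.

Local Open Scope classical_set_scope.
Local Open Scope ring_scope.
Local Open Scope complex_scope.

(** Write e_n(t) for the exponential exp(i omega_n t) and B_n for the resolvent
    of A at i omega_n.  The forcing e_n y, started from the state 0, produces
    the mild solution e_n(t) B_n y - S(t) B_n y ([wave_response]).  The second
    term dies out by strong stability, so a large |B_n y| is eventually visible
    as a large solution.  The proof has two halves.

    Infinite derivative loss prevents the norms of the B_n from being bounded
    by any polynomial in omega_n ([infinite_loss_resolvent]).  Suppose
    |B_n y| <= C (1 + |omega_n|)^p |y|, and let u be a T-periodic mild solution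
    for a forcing f with p + 2 weak derivatives.  The Fourier coefficients a_n
    of f decay like |omega_n|^-(p+2), since p + 2 weak derivatives tested
    against e_n multiply the coefficient by (i omega_n)^(p+2).  Hence the a_n
    and the B_n a_n are absolutely summable, with sums controlled by the
    Sobolev norm of f.  Let F be the sum of the e_n a_n and Z that of the
    B_n a_n.  The forcing F contributes Z - S(T) Z over one period, and the
    forcing f contributes the same, because f - F has vanishing Fourier
    coefficients and therefore does not act at all ([interval_integral0],
    [orbit_integral0]).  Periodicity of u then reads
    (I - S(T)) u(0) = (I - S(T)) Z, and I - S(T) is injective by strong
    stability ([stable_fixed_point]), so u(0) = Z.  This bounds u by the
    Sobolev norm of f ([periodic_solution_le]): no loss of p + 3 derivatives.

    If the resolvents grow faster than every polynomial, a gliding hump gives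
    the resonant forcing ([gliding_humps], [resonant_forcing]).  One chooses
    inductively n_j, y_j and a time t_j such that (1 + |omega_{n_j}|)^j |y_j|
    is at most 2^-j, which makes f, the sum of the e_{n_j} y_j, smooth; the
    response to the j-th term at time t_j exceeds the responses to all earlier
    terms by j; and the later terms are too small to matter before t_j.  The
    solution started from 0 is then unbounded, which is secular resonance.
    Since S is bounded, every mild solution is unbounded along with it, whereas
    a periodic one would be bounded: this is static resonance
    ([unbounded_response_resonant]).

    All integrals of vector-valued functions are handled through
    [weak_integral], that is, by composing with the bounded real functionals,
    which norm a Hilbert space ([hilbert_norming]).  Each statement about them
    thereby becomes one about real Lebesgue integrals. *)

(** * Real-valued norms on complex normed spaces *)

Section RealNorm.
Context {R : realType} {V : normedModType R[i]}.
Implicit Types (x y : V) (c : R[i]) (r : R).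

Lemma rnormE x : `|x| = (rnorm x)%:C.
Proof. by rewrite /rnorm RRe_real// ger0_real. Qed.

Lemma rnorm_ge0 x : 0 <= rnorm x.
Proof. by rewrite -ler0c -rnormE. Qed.

Lemma rnormD x y : rnorm (x + y) <= rnorm x + rnorm y.
Proof. by rewrite -lecR rmorphD/= -!rnormE ler_normD. Qed.

Lemma rnormN x : rnorm (- x) = rnorm x.
Proof. by rewrite /rnorm normrN. Qed.

Lemma rnormBC x y : rnorm (x - y) = rnorm (y - x).
Proof. by rewrite /rnorm distrC. Qed.

Lemma rnorm0 : rnorm (0 : V) = 0.
Proof. by rewrite /rnorm normr0. Qed.

Lemma rnorm_eq0 x : rnorm x = 0 -> x = 0.
Proof. by move=> x0; apply/normr0_eq0; rewrite rnormE x0. Qed.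

Lemma rnormB_le x y : rnorm (x - y) <= rnorm x + rnorm y.
Proof. by rewrite (le_trans (rnormD _ _))// rnormN. Qed.

Lemma rnorm_dist x y : rnorm x - rnorm y <= rnorm (x - y).
Proof. by rewrite lerBlDr -[in leLHS](subrK y x) rnormD. Qed.

Lemma rnorm_dist_abs x y : `|rnorm x - rnorm y| <= rnorm (x - y).
Proof. by rewrite ler_norml rnorm_dist andbT lerNl opprB rnormBC rnorm_dist. Qed.

Lemma rnorm_sum (I : Type) (r : seq I) (F : I -> V) :
  rnorm (\sum_(k <- r) F k) <= \sum_(k <- r) rnorm (F k).
Proof.
elim: r => [|k r IH]; first by rewrite !big_nil rnorm0.
by rewrite !big_cons/= (le_trans (rnormD _ _))// lerD2l.
Qed.

Lemma rnormZ c x : rnorm (c *: x) = complex.Re `|c| * rnorm x.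
Proof.
apply: (@complexI R); rewrite -rnormE normrZ rnormE rmorphM/=; congr (_ * _).
Qed.

Lemma Re_normr r : complex.Re `|r%:C| = `|r|.
Proof. by rewrite normc_def/= expr0n/= addr0 sqrtr_sqr. Qed.

Lemma rnormZr r x : rnorm (r%:C *: x) = `|r| * rnorm x.
Proof. by rewrite rnormZ Re_normr. Qed.

Lemma cvg_rnormP {I : Type} (F : set_system I) {FF : Filter F} (f : I -> V) (l : V) :
  f @ F --> l <-> (forall e : R, 0 < e -> \forall t \near F, rnorm (f t - l) < e).
Proof.
split=> [/cvgrPdist_lt fl e e0|h].
  have e0' : 0 < e%:C :> R[i] by rewrite ltcR.
  move: (fl _ e0'); apply: filterS => t /=.
  by rewrite rnormE ltcR rnormBC.
apply/cvgrPdist_lt => e e0.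
have eE : e = (complex.Re e)%:C by rewrite RRe_real// gtr0_real.
have : 0 < complex.Re e by rewrite -ltcR -eE.
move=> /h; apply: filterS => t.
by rewrite rnormE rnormBC [e]eE ltcR.
Qed.

Lemma cvg_rnorm0 {I : Type} (F : set_system I) {FF : Filter F} (f : I -> V) (l : V) :
  f @ F --> l <-> rnorm (f t - l) @[t --> F] --> (0 : R).
Proof.
split=> [/cvg_rnormP fl|/cvgrPdist_lt fl].
  apply/cvgrPdist_lt => e /fl; apply: filterS => t.
  by rewrite sub0r normrN ger0_norm// rnorm_ge0.
apply/cvg_rnormP => e /fl; apply: filterS => t.
by rewrite sub0r normrN ger0_norm// rnorm_ge0.
Qed.

Lemma cvg_rnorm {I : Type} (F : set_system I) {FF : Filter F} (f : I -> V) (l : V) :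
  f @ F --> l -> rnorm (f t) @[t --> F] --> rnorm l.
Proof.
move=> /cvg_rnormP fl; apply/cvgrPdist_lt => e /fl; apply: filterS => t.
by apply: le_lt_trans; rewrite distrC rnorm_dist_abs.
Qed.

End RealNorm.

Section Series.
Context {R : realType} {V : completeNormedModType R[i]}.

Lemma rnorm_cauchy (s : nat -> V) :
  (forall e : R, 0 < e -> exists N, forall n, (N <= n)%N -> rnorm (s n - s N) < e) ->
  exists l : V, s @ \oo --> l.
Proof.
move=> sC; apply/cvg_ex/cauchy_cvgP/cauchy_exP => e e0.
have eE : e = (complex.Re e)%:C by rewrite RRe_real// gtr0_real.
have /sC[N hN] : 0 < complex.Re e by rewrite -ltcR -eE.
exists (s N), N => // m /= /hN sm.
by rewrite /= -ball_normE /ball_/= rnormE [e]eE ltcR rnormBC.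
Qed.

Lemma rnorm_complete (s : nat -> V) (b : nat -> R) :
  b @ \oo --> 0 ->
  (forall m n, (m <= n)%N -> rnorm (s n - s m) <= b m) ->
  exists l : V, forall n, rnorm (l - s n) <= b n.
Proof.
move=> b0 sb; have [|l sl] := @rnorm_cauchy s.
  move=> e e0; have /cvgrPdist_lt/(_ _ e0)[N _ hN] := b0.
  exists N => n Nn; apply: (le_lt_trans (sb _ _ Nn)).
  have := hN N (leqnn N) => /=; rewrite sub0r normrN.
  by apply/le_lt_trans/ler_norm.
exists l => n.
have : rnorm (s k - s n) @[k --> \oo] --> rnorm (l - s n).
  by apply: cvg_rnorm; apply: cvgB => //; exact: cvg_cst.
move=> /cvgr_to_le; apply.
by exists n => // k /= nk; exact: sb.
Qed.

(** The majorant is given by the differences of a null sequence because these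
    telescope: the tail after n terms is then bounded by [b n] itself, and no
    sum of a series has to be computed. *)
Lemma rnorm_series (u : nat -> V) (b : nat -> R) :
  b @ \oo --> 0 -> (forall k, 0 <= b k) ->
  (forall k, rnorm (u k) <= b k - b k.+1) ->
  exists l : V, forall n, rnorm (l - \sum_(k < n) u k) <= b n.
Proof.
move=> b0 bp ub; apply: rnorm_complete => // m n mn.
suff : rnorm (\sum_(k < n) u k - \sum_(k < m) u k) <= b m - b n.
  by move=> /le_trans; apply; rewrite lerBlDr lerDl.
elim: n mn => [|n IH]; first by rewrite leqn0 => /eqP ->; rewrite !subrr rnorm0.
rewrite leq_eqVlt => /predU1P[->|mn]; first by rewrite !subrr rnorm0.
rewrite big_ord_recr/= addrAC (le_trans (rnormD _ _))//.
by have := IH mn; have := ub n; lra.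
Qed.

End Series.

(** * Real-valued Lebesgue integrals *)

Local Notation leb := (@lebesgue_measure _).
Local Notation Rintegrable D g := (leb.-integrable D (EFin \o g)).

Section RealIntegrals.
Context {R : realType}.
Local Notation RR := (measurableTypeR R).
Implicit Types (D : set RR) (f g h : RR -> R).

Lemma Rintegrable_le D f g : measurable D -> measurable_fun D f ->
  Rintegrable D g -> (forall t, D t -> `|f t| <= g t) -> Rintegrable D f.
Proof.
move=> mD mf ig fg; apply: (le_integrable mD _ _ ig); first exact/measurable_EFinP.
move=> t Dt /=; rewrite lee_fin (le_trans (fg _ Dt))//; exact: ler_norm.
Qed.

Lemma Rintegrable_bounded D f (K : R) : measurable D -> (leb D < +oo)%E ->
  measurable_fun D f -> (forall t, D t -> `|f t| <= K) -> Rintegrable D f.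
Proof.
move=> mD Doo mf fK; apply: (measurable_bounded_integrable mD) => //.
exists K; split; first exact: num_real.
by move=> M KM t Dt /=; rewrite (le_trans (fK _ Dt))// ltW.
Qed.

Lemma RintegrableD D f g : measurable D -> Rintegrable D f -> Rintegrable D g ->
  Rintegrable D (fun t => f t + g t).
Proof. by move=> mD fi gi; exact: (integrableD mD fi gi). Qed.

Lemma RintegrableB D f g : measurable D -> Rintegrable D f -> Rintegrable D g ->
  Rintegrable D (fun t => f t - g t).
Proof. by move=> mD fi gi; exact: (integrableB mD fi gi). Qed.

Lemma RintegrableZ D f (r : R) : measurable D -> Rintegrable D f ->
  Rintegrable D (fun t => r * f t).
Proof. by move=> mD fi; exact: (integrableZl mD r fi). Qed.

Lemma eq_Rintegrable D f g : measurable D -> (forall t, D t -> f t = g t) ->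
  Rintegrable D f -> Rintegrable D g.
Proof.
move=> mD fg; apply: eq_integrable => // t /set_mem Dt /=; by rewrite fg.
Qed.

Lemma Rintegrable_measurable D f : Rintegrable D f -> measurable_fun D f.
Proof. by move=> /measurable_int/measurable_EFinP. Qed.

Lemma Rintegrable_cst D (r : R) : measurable D -> (leb D < +oo)%E ->
  Rintegrable D (cst r).
Proof.
move=> mD Doo; apply: (@Rintegrable_bounded _ _ `|r|) => //.
Qed.

Lemma Rintegrable_norm D f : measurable D -> Rintegrable D f ->
  Rintegrable D (fun t => `|f t|).
Proof.
move=> mD fi; apply: (le_integrable mD _ _ fi).
  apply/measurable_EFinP; apply: measurableT_comp => //.
  exact: Rintegrable_measurable fi.
by move=> t Dt /=; rewrite lee_fin normr_id.
Qed.

Lemma Rintegral_dist D f g h : measurable D -> 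
  Rintegrable D f -> Rintegrable D g -> Rintegrable D h ->
  (forall t, D t -> `|f t - g t| <= h t) ->
  `|\int[leb]_(t in D) f t - \int[leb]_(t in D) g t| <= \int[leb]_(t in D) h t.
Proof.
move=> mD fi gi hi fg; rewrite -RintegralB//.
rewrite (le_trans (le_normr_Rintegral mD (RintegrableB mD fi gi)))//.
apply: le_Rintegral => //.
exact: Rintegrable_norm (RintegrableB mD fi gi).
Qed.

Lemma Rintegral_dist_cst D f g (c : R) : measurable D -> (leb D < +oo)%E ->
  Rintegrable D f -> Rintegrable D g ->
  (forall t, D t -> `|f t - g t| <= c) ->
  `|\int[leb]_(t in D) f t - \int[leb]_(t in D) g t| <= c * fine (leb D).
Proof.
move=> mD Doo fi gi fg; rewrite -[leRHS](Rintegral_cst _ mD).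
exact: Rintegral_dist (Rintegrable_cst _ mD Doo) _.
Qed.

Lemma Rintegrable_sum (I : Type) (r : seq I) (F : I -> RR -> R) D : measurable D ->
  (forall i, Rintegrable D (F i)) ->
  Rintegrable D (fun t => \sum_(i <- r) F i t) /\
  \int[leb]_(t in D) (\sum_(i <- r) F i t) = \sum_(i <- r) \int[leb]_(t in D) F i t.
Proof.
move=> mD iF; elim: r => [|i r [IH1 IH2]].
  rewrite big_nil; under eq_Rintegral do rewrite big_nil.
  split; last by rewrite Rintegral_cst// mul0r.
  apply: (@eq_Rintegrable _ (cst 0)) => //; first by move=> t _; rewrite big_nil.
  exact: integrable0.
rewrite big_cons; under eq_Rintegral do rewrite big_cons.
rewrite RintegralD//; split; last by rewrite IH2.
apply: (@eq_Rintegrable _ (fun t => F i t + \sum_(j <- r) F j t)) => //.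
  by move=> t _; rewrite big_cons.
exact: RintegrableD.
Qed.

Lemma Rdominated D (f_ : nat -> RR -> R) f g : measurable D ->
  (forall n, measurable_fun D (f_ n)) ->
  (forall t, D t -> f_ n t @[n --> \oo] --> f t) ->
  Rintegrable D g -> (forall n t, D t -> `|f_ n t| <= g t) ->
  Rintegrable D f /\
  \int[leb]_(t in D) f_ n t @[n --> \oo] --> \int[leb]_(t in D) f t.
Proof.
move=> mD mf_ f_f ig f_g.
have mf : measurable_fun D f by exact: measurable_fun_cvg mf_ f_f.
have [] := @dominated_convergence _ _ _ (@lebesgue_measure R) D mD
  (fun n => EFin \o f_ n) (EFin \o f) (EFin \o g).
- by move=> n; exact/measurable_EFinP.
- exact/measurable_EFinP.
- by apply: aeW => t Dt; apply: cvg_EFin; [exact: nearW|exact: f_f].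
- exact: ig.
- by apply: aeW => t n Dt; rewrite lee_fin f_g.
move=> fi _ fcvg; split => //.
apply: fine_cvg; rewrite fineK; first exact: fcvg.
exact: integrable_fin_num.
Qed.

Lemma cvg_dist_le (u b : nat -> R) (c : R) : b @ \oo --> 0 ->
  (forall n, `|u n - c| <= b n) -> u @ \oo --> c.
Proof.
move=> /cvgrPdist_lt b0 ub; apply/cvgrPdist_lt => e /b0; apply: filterS => n.
rewrite sub0r normrN distrC => bn; rewrite (le_lt_trans (ub n))//.
by rewrite (le_lt_trans (ler_norm _)).
Qed.

End RealIntegrals.

(** * Bounded real functionals and weak integrals *)

Section Functionals.
Context {R : realType} {V : normedModType R[i]}.
Local Notation RR := (measurableTypeR R).
Implicit Types (l : V -> R) (x y : V) (D : set RR) (f g : RR -> V).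

(** Real-linear and real-valued, so that composing with [l] yields real
    Lebesgue integrals.  No information is lost over the complex numbers, as
    [fun x => l (c *: x)] is again such a functional ([rf_scale]). *)
Definition real_functional l : Prop :=
  [/\ forall x y, l (x + y) = l x + l y,
      forall (r : R) x, l (r%:C *: x) = r * l x
    & exists2 C : R, 0 <= C & forall x, `|l x| <= C * rnorm x].

Section Props.
Variables (l : V -> R) (hl : real_functional l).

Lemma rfD x y : l (x + y) = l x + l y. Proof. by case: hl. Qed.
Lemma rfZ (r : R) x : l (r%:C *: x) = r * l x. Proof. by case: hl. Qed.
Lemma rf0 : l 0 = 0.
Proof. by have := rfZ 0 0; rewrite scaler0 mul0r. Qed.
Lemma rfN x : l (- x) = - l x.
Proof. by apply/eqP; rewrite -addr_eq0 -rfD addNr rf0. Qed.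
Lemma rfB x y : l (x - y) = l x - l y.
Proof. by rewrite rfD rfN. Qed.
Lemma rf_sum (I : Type) (r : seq I) (F : I -> V) :
  l (\sum_(i <- r) F i) = \sum_(i <- r) l (F i).
Proof. by elim: r => [|i r IH]; rewrite ?big_nil ?rf0// !big_cons rfD IH. Qed.

Lemma rf_cvg {I : Type} (F : set_system I) {FF : Filter F} (f : I -> V) (v : V) :
  f @ F --> v -> l (f t) @[t --> F] --> l v.
Proof.
case: hl => _ _ [C C0 lC] /cvg_rnormP fv; apply/cvgrPdist_lt => e e0.
have C1 : 0 < C + 1 by lra.
have := fv _ (divr_gt0 e0 C1); apply: filterS => t ht.
rewrite distrC -rfB (le_lt_trans (lC _))//.
rewrite ltr_pdivlMr// in ht; apply: le_lt_trans ht.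
by rewrite mulrC ler_wpM2l ?rnorm_ge0//; lra.
Qed.

Lemma rf_scale (c : R[i]) : real_functional (fun x => l (c *: x)).
Proof.
split.
- by move=> x y; rewrite scalerDr rfD.
- by move=> r x; rewrite scalerA mulrC -scalerA rfZ.
- case: hl => _ _ [C C0 lC]; exists (C * complex.Re `|c|).
    rewrite mulr_ge0//; have := rnorm_ge0 (c : R[i]^o).
    by rewrite /rnorm.
  by move=> x; rewrite (le_trans (lC _))// rnormZ mulrA.
Qed.

Lemma rf_comp (B : {linear V -> V}) (M : R) : 0 <= M ->
  (forall x, rnorm (B x) <= M * rnorm x) -> real_functional (fun x => l (B x)).
Proof.
move=> M0 BM; split.
- by move=> x y; rewrite linearD rfD.
- by move=> r x; rewrite linearZ/= rfZ.
- case: hl => _ _ [C C0 lC]; exists (C * M); first exact: mulr_ge0.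
  by move=> x; rewrite (le_trans (lC _))// -mulrA ler_wpM2l.
Qed.

End Props.

(** Integration against all bounded functionals determines the integral of a
    vector-valued function, and turns every manipulation of it into one of real
    Lebesgue integrals. *)
Definition weak_integral D f (v : V) : Prop :=
  forall l, real_functional l ->
    Rintegrable D (fun t => l (f t)) /\ \int[leb]_(t in D) l (f t) = l v.

(** This is the part of the Hahn-Banach theorem used below; in a Hilbert space
    the functional is the inner product with a normalized vector. *)
Definition norming : Prop :=
  forall v : V, exists l,
    [/\ real_functional l, forall x, `|l x| <= rnorm x & l v = rnorm v].

Lemma eq_weak_integral D f g v : measurable D -> (forall t, D t -> f t = g t) ->
  weak_integral D f v -> weak_integral D g v.
Proof.
move=> mD fg fv l hl; have [i1 i2] := fv l hl; split.
  by apply: eq_Rintegrable i1 => // t Dt; rewrite fg.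
by rewrite -i2; apply: eq_Rintegral => t /set_mem Dt; rewrite fg.
Qed.

Lemma weak_integralD D f g v w : measurable D ->
  weak_integral D f v -> weak_integral D g w ->
  weak_integral D (fun t => f t + g t) (v + w).
Proof.
move=> mD fv gw l hl; have [f1 f2] := fv l hl; have [g1 g2] := gw l hl.
have E : forall t, l (f t + g t) = l (f t) + l (g t) by move=> t; rewrite rfD.
split; first by apply: eq_Rintegrable (RintegrableD mD f1 g1).
by under eq_Rintegral do rewrite E; rewrite RintegralD// f2 g2 rfD.
Qed.

Lemma weak_integralZ D f v (c : R[i]) : measurable D ->
  weak_integral D f v -> weak_integral D (fun t => c *: f t) (c *: v).
Proof. by move=> mD fv l hl; exact: (fv _ (rf_scale hl c)). Qed.

Lemma weak_integralB D f g v w : measurable D ->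
  weak_integral D f v -> weak_integral D g w ->
  weak_integral D (fun t => f t - g t) (v - w).
Proof.
move=> mD fv gw.
have := weak_integralD mD fv (weak_integralZ (-1) mD gw).
by rewrite scaleN1r; apply: eq_weak_integral => // t _; rewrite scaleN1r.
Qed.

Lemma weak_integral_sum D n (F : nat -> RR -> V) (v : nat -> V) : measurable D ->
  (forall k, weak_integral D (F k) (v k)) ->
  weak_integral D (fun t => \sum_(k < n) F k t) (\sum_(k < n) v k).
Proof.
move=> mD Fv l hl.
have E t : l (\sum_(k < n) F k t) = \sum_(k < n) l (F k t) by rewrite rf_sum.
have [i1 i2] := @Rintegrable_sum _ _ (index_enum 'I_n)
  (fun k t => l (F k t)) D mD (fun k => (Fv k l hl).1).
split; first exact: eq_Rintegrable i1.
under eq_Rintegral do rewrite E.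
by rewrite i2 rf_sum//; apply: eq_bigr => k _; exact: (Fv k l hl).2.
Qed.

Hypothesis Vnorming : norming.

Lemma weak_integral_unique D f v w :
  weak_integral D f v -> weak_integral D f w -> v = w.
Proof.
move=> fv fw; apply/eqP; rewrite -subr_eq0; apply/eqP/rnorm_eq0.
have [l [hl _ <-]] := Vnorming (v - w).
by rewrite rfB// -(fv l hl).2 (fw l hl).2 subrr.
Qed.

Lemma weak_integral_le D f v (g : RR -> R) : measurable D ->
  weak_integral D f v -> Rintegrable D g ->
  (forall t, D t -> rnorm (f t) <= g t) -> rnorm v <= \int[leb]_(t in D) g t.
Proof.
move=> mD fv ig fg; have [l [hl lb <-]] := Vnorming v.
have [i1 <-] := fv l hl; apply: le_Rintegral => // t Dt.
by rewrite (le_trans (ler_norm _))// (le_trans (lb _))// fg.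
Qed.

End Functionals.

Section HilbertNorming.
Context {R : realType} {H : normedModType R[i]}.
Variables (dot : {dot H for Num.conj}) (norm_dot : forall x : H, `|x| ^+ 2 = dot x x).

Lemma rnorm_sqr (x : H) : ((rnorm x) ^+ 2)%:C = dot x x.
Proof. by rewrite -norm_dot rnormE rmorphXn. Qed.

(** The functional is l x = Re <x, u> with u the normalization of v.  Its
    bound by the norm is |x - l(x) u|^2 = |x|^2 - l(x)^2 >= 0. *)
Lemma hilbert_norming : @norming R H.
Proof.
move=> v; have [->|v0] := eqVneq v 0.
  exists (cst 0); split; last by rewrite rnorm0.
    split; [by move=> *; rewrite addr0|by move=> *; rewrite mulr0|].
    by exists 0 => // x; rewrite normr0 mul0r.
  by move=> x; rewrite normr0 rnorm_ge0.
have nv : 0 < rnorm v.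
  by rewrite lt_def rnorm_ge0 andbT; apply: contra_neq v0; exact: rnorm_eq0.
pose u := (rnorm v)^-1%:C *: v.
have u1 : rnorm u = 1.
  by rewrite /u rnormZr ger0_norm ?invr_ge0 ?rnorm_ge0// mulVf// gt_eqF.
pose l x := complex.Re (dot x u).
have lD x y : l (x + y) = l x + l y.
  by rewrite /l linearDl/= raddfD.
have lZ (r : R) x : l (r%:C *: x) = r * l x.
  by rewrite /l linearZl_LR/=; case: (dot x u) => a b /=; rewrite mul0r subr0.
have lb x : `|l x| <= rnorm x.
  have : ((rnorm (x - (l x)%:C *: u)) ^+ 2)%:C =
         ((rnorm x) ^+ 2 - (l x) ^+ 2)%:C.
    rewrite rnorm_sqr dnormB -!rnorm_sqr rnormZr u1 mulr1.
    rewrite linearZr_LR/=.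
    rewrite real_normK ?num_real// /l; case: (dot x u) => a b /=.
    apply/eqP; rewrite eq_complex /=; apply/andP; split; apply/eqP; ring.
  move=> /complexI h.
  have := sqr_ge0 (rnorm (x - (l x)%:C *: u)); rewrite h subr_ge0.
  by rewrite -[leLHS]real_normK ?num_real// ler_pXn2r// nnegrE ?rnorm_ge0.
exists l; split => //.
  by split => //; exists 1 => // x; rewrite mul1r.
rewrite /l /u linearZr_LR/=.
rewrite -rnorm_sqr/= mulr0 subr0 expr2 mulrA mulVf ?mul1r// gt_eqF//.
Qed.

End HilbertNorming.

Section UniformLimit.
Context {R : realType} {V : normedModType R[i]}.
Local Notation RR := (measurableTypeR R).

(** Used with partial sums for [f_]: a uniformly convergent series may be
    integrated term by term. *)
Lemma weak_integral_lim (D : set RR) (f_ : nat -> RR -> V) (f : RR -> V)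
    (v_ : nat -> V) (v : V) (b : nat -> R) : measurable D -> (leb D < +oo)%E ->
  (forall n, weak_integral D (f_ n) (v_ n)) ->
  v_ n @[n --> \oo] --> v -> b n @[n --> \oo] --> 0 ->
  (forall n t, D t -> rnorm (f t - f_ n t) <= b n) ->
  weak_integral D f v.
Proof.
move=> mD Doo fv vv b0 fb l hl; have [lD lZ [C C0 lC]] := hl.
have lfb n t : D t -> `|l (f t) - l (f_ n t)| <= C * b n.
  by move=> Dt; rewrite -rfB// (le_trans (lC _))// ler_wpM2l// fb.
have mf_ n : measurable_fun D (fun t => l (f_ n t)).
  exact: Rintegrable_measurable (fv n l hl).1.
have fcv t : D t -> l (f_ n t) @[n --> \oo] --> l (f t).
  move=> Dt; apply: rf_cvg => //; apply/cvg_rnormP => e e0.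
  move/cvgrPdist_lt : b0 => /(_ _ e0); apply: filterS => n.
  rewrite sub0r normrN => bn; rewrite rnormBC (le_lt_trans (fb _ _ Dt))//.
  by rewrite (le_lt_trans (ler_norm _)).
have mf : measurable_fun D (fun t => l (f t)) by exact: measurable_fun_cvg mf_ fcv.
have if_ n : Rintegrable D (fun t => l (f_ n t)) := (fv n l hl).1.
have ifl : Rintegrable D (fun t => l (f t)).
  apply: (@Rintegrable_le _ _ _ (fun t => `|l (f_ 0%N t)| + C * b 0%N)) => //.
    apply: RintegrableD => //; last exact: Rintegrable_cst.
    exact: Rintegrable_norm.
  move=> t Dt; have := lfb 0%N t Dt.
  by have := lerB_dist (l (f t)) (l (f_ 0%N t)); lra.
split => //.
have i_l : \int[leb]_(t in D) l (f_ n t) @[n --> \oo] --> \int[leb]_(t in D) l (f t).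
  apply: (@cvg_dist_le _ _ (fun n => C * b n * fine (leb D))).
    rewrite -[X in _ --> X](mul0r (fine (leb D))); apply: cvgMl.
    by rewrite -[X in _ --> X](mulr0 C); apply: cvgMr.
  move=> n; rewrite distrC; apply: Rintegral_dist_cst => // t Dt; exact: lfb.
have l_l : \int[leb]_(t in D) l (f_ n t) @[n --> \oo] --> l v.
  by under eq_fun do rewrite (fv _ l hl).2; exact: rf_cvg.
exact: (cvg_unique _ i_l l_l).
Qed.

End UniformLimit.

(** * Simple functions and Bochner integrals *)

Section Simple.
Context {R : realType} {V : normedModType R[i]}.
Local Notation RR := (measurableTypeR R).
Implicit Types (s : R -> V) (D : set RR).

Lemma simple_cst (v : V) : simple_function (fun _ : R => v).
Proof.
split.
  apply: (sub_finite_set _ (finite_set1 v)) => _ [t _ <-] //.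
move=> w; rewrite (_ : _ @^-1` _ = if v == w then setT else set0).
  by case: ifP => _; [exact: measurableT|exact: measurable0].
by apply/seteqP; split => t /=; case: eqP.
Qed.

Lemma simple_if (E : set RR) s s' : measurable E ->
  simple_function s -> simple_function s' ->
  simple_function (fun t => if t \in E then s t else s' t).
Proof.
move=> mE [fs ms] [fs' ms']; split.
  apply: (@sub_finite_set _ _ (range s `|` range s')); last by rewrite finite_setU.
  by move=> _ [t _ <-]; case: ifP => _; [left|right]; exists t.
move=> v; rewrite (_ : _ @^-1` _ = (E `&` s @^-1` [set v]) `|` (~` E `&` s' @^-1` [set v])).
  have mC : measurable (~` E : set RR) by exact: measurableC.
  have m1 : measurable (E `&` s @^-1` [set v] : set RR).
    by apply: measurableI => //; exact: ms.
  have m2 : measurable (~` E `&` s' @^-1` [set v] : set RR).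
    by apply: measurableI => //; exact: ms'.
  exact: (measurableU _ _ m1 m2).
apply/seteqP; split => t /=.
  by case: ifPn => [/set_mem tE|/negP tE] sv; [left|right]; split => // /mem_set.
by case=> -[tE sv]; [rewrite mem_set|rewrite memNset].
Qed.

Lemma simple_measurable (g : V -> R) s : simple_function s ->
  measurable_fun setT (fun t : RR => g (s t)).
Proof.
move=> [fs ms] _ Y mY; rewrite setTI.
rewrite (_ : _ @^-1` _ = \bigcup_(v in range s `&` g @^-1` Y) s @^-1` [set v]).
  apply: (@fin_bigcup_measurable _ RR); first exact: finite_setIl.
  by move=> v _; exact: ms.
apply/seteqP; split => t /=.
  by move=> Yt; exists (s t) => //; split => //; exists t.
by move=> [v [_ Yv] sv]; rewrite sv.
Qed.

Lemma simple_measurable2 (g : V -> V -> R) s s' : simple_function s ->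
  simple_function s' -> measurable_fun setT (fun t : RR => g (s t) (s' t)).
Proof.
move=> [fs ms] hs' _ Y mY; rewrite setTI.
rewrite (_ : _ @^-1` _ =
    \bigcup_(v in range s) (s @^-1` [set v] `&` (fun t => g v (s' t)) @^-1` Y)).
  apply: (@fin_bigcup_measurable _ RR) => // v _.
  apply: measurableI; first exact: ms.
  rewrite -[X in measurable X]setTI; exact: (simple_measurable (g v) hs').
apply/seteqP; split => t /=.
  by move=> Yt; exists (s t) => //; exists t.
by move=> [v _ [-> ]].
Qed.

(** After composition with a functional [l], a simple function is the finite
    sum of its values [l v] times indicators of its level sets. *)
Lemma simple_weak_integral D s : measurable D -> (leb D < +oo)%E ->
  simple_function s -> weak_integral D s (simple_integral D s).
Proof.
move=> mD Doo [fs ms] l hl.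
have mI v : measurable (D `&` s @^-1` [set v]).
  by apply: measurableI => //; exact: ms.
set r := finmap.enum_fset (fset_set (range s)).
have lsE t : l (s t) = \sum_(v <- r) l v * \1_(s @^-1` [set v]) t.
  rewrite (bigD1_seq (s t))/= ?finmap.fset_uniq//; last first.
    by rewrite in_fset_set//; apply/mem_set; exists t.
  rewrite indicE mem_set//= mulr1 big1 ?addr0// => v vt.
  by rewrite indicE memNset ?mulr0//= => sv; rewrite sv eqxx in vt.
have ii v : Rintegrable D (\1_(s @^-1` [set v]) : RR -> R).
  apply: (@Rintegrable_bounded _ _ _ 1) => //.
    by apply/measurable_funTS/measurable_indicP; exact: ms.
  by move=> t _; rewrite indicE; case: (_ \in _); rewrite ?normr1 ?normr0.
have [i1 i2] := @Rintegrable_sum _ _ r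
  (fun v t => l v * \1_(s @^-1` [set v]) t) D mD (fun v => RintegrableZ (l v) mD (ii v)).
split; first exact: eq_Rintegrable i1.
under eq_Rintegral do rewrite lsE.
rewrite i2 /simple_integral fsbig_finite// rf_sum//; apply: eq_bigr => v _.
rewrite rfZ// RintegralZl// mulrC; congr (_ * _).
by rewrite /Rintegral integral_indic//; [rewrite setIC|exact: ms].
Qed.

End Simple.

Lemma cvge0_lt {R : realType} (u : nat -> \bar R) (e : R) : 0 < e ->
  u @ \oo --> 0%E -> \forall n \near \oo, (u n < e%:E)%E.
Proof.
move=> e0 /fine_cvgP[ufin /cvgrPdist_lt/(_ _ e0)].
apply: filterS2 ufin => n un; rewrite sub0r normrN /= => h.
by rewrite -(fineK un) lte_fin (le_lt_trans (ler_norm _)).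
Qed.

Section Bochner.
Context {R : realType} {V : normedModType R[i]}.
Local Notation RR := (measurableTypeR R).
Implicit Types (D : set RR) (f : RR -> V).

Lemma strongly_measurable_comp D f (g : V -> R) : measurable D ->
  strongly_measurable D f ->
  (forall t (s : nat -> V), s n @[n --> \oo] --> f t -> g (s n) @[n --> \oo] --> g (f t)) ->
  measurable_fun D (fun t => g (f t)).
Proof.
move=> mD [s [ss sf]] gc; apply: (@measurable_fun_cvg _ _ _ D (fun n t => g (s n t))).
  by move=> n; apply: measurable_funTS; exact: simple_measurable.
by move=> t Dt; apply: gc; exact: sf.
Qed.

Lemma measurable_rnorm D f : measurable D -> strongly_measurable D f ->
  measurable_fun D (fun t => rnorm (f t)).
Proof.
by move=> mD fm; apply: strongly_measurable_comp fm _ => // t s; exact: cvg_rnorm.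
Qed.

Lemma measurable_rnormB_simple D f (s : R -> V) : measurable D ->
  strongly_measurable D f -> simple_function s ->
  measurable_fun D (fun t => rnorm (f t - s t)).
Proof.
move=> mD [s_ [ss sf]] hs.
apply: (@measurable_fun_cvg _ _ _ D (fun n t => rnorm (s_ n t - s t))).
  move=> n; apply: measurable_funTS.
  exact: (simple_measurable2 (fun v w => rnorm (v - w))).
by move=> t Dt; apply: cvg_rnorm; apply: cvgB; [exact: sf|exact: cvg_cst].
Qed.

(** A functional is Lipschitz, so convergence of the simple functions to [f] in
    mean gives convergence of the integrals of their compositions with [l]. *)
Lemma is_bochner_integral_weak D f v : measurable D -> (leb D < +oo)%E ->
  is_bochner_integral D f v -> weak_integral D f v.
Proof.
move=> mD Doo [s [ss sf sI sv]] l hl; have [_ _ [C C0 lC]] := hl.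
have fm : strongly_measurable D f by exists s.
have mlf : measurable_fun D (fun t => l (f t)).
  by apply: strongly_measurable_comp fm _ => // t u; exact: rf_cvg.
have ils n := simple_weak_integral mD Doo (ss n) hl.
have d0 t n : 0 <= rnorm (f t - s n t) by exact: rnorm_ge0.
have id : \forall n \near \oo, Rintegrable D (fun t => rnorm (f t - s n t)).
  have : \forall n \near \oo,
      (\int[leb]_(t in D) (rnorm (f t - s n t))%:E < 1%:E)%E.
    by apply: cvge0_lt sI; exact: ltr01.
  apply: filterS => n hn; apply/integrableP; split.
    by apply/measurable_EFinP; apply: measurable_rnormB_simple.
  under eq_integral do rewrite /= ger0_norm//.
  by rewrite (lt_trans hn)// ltry.
have ilf : Rintegrable D (fun t => l (f t)).
  have [n hn] := @filter_ex _ _ _ _ id.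
  apply: (@Rintegrable_le _ _ _ (fun t => C * rnorm (f t - s n t) + `|l (s n t)|)) => //.
    apply: RintegrableD => //; first exact: RintegrableZ.
    by apply: Rintegrable_norm => //; exact: (ils n).1.
  move=> t Dt; have := lC (f t - s n t); rewrite rfB//.
  by have := lerB_dist (l (f t)) (l (s n t)); lra.
split => //.
have i_l : \int[leb]_(t in D) l (s n t) @[n --> \oo] --> \int[leb]_(t in D) l (f t).
  apply/cvgrPdist_lt => e e0.
  have C1 : 0 < C + 1 by lra.
  have : \forall n \near \oo,
      (\int[leb]_(t in D) (rnorm (f t - s n t))%:E < (e / (C + 1))%:E)%E.
    by apply: cvge0_lt sI; exact: divr_gt0.
  move: id; apply: filterS2 => n idn hn.
  have := Rintegral_dist mD ilf (ils n).1 (RintegrableZ C mD idn).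
  move=> /(_ _)/le_lt_trans; apply.
    by move=> t Dt; rewrite -rfB.
  rewrite RintegralZl//.
  have : \int[leb]_(t in D) rnorm (f t - s n t) < e / (C + 1).
    by rewrite -lte_fin /Rintegral fineK//; exact: integrable_fin_num idn.
  rewrite ltr_pdivlMr// => h; apply: le_lt_trans h.
  by rewrite mulrC ler_wpM2l ?Rintegral_ge0//; lra.
have l_l : \int[leb]_(t in D) l (s n t) @[n --> \oo] --> l v.
  by under eq_fun do rewrite (ils _).2; exact: rf_cvg.
exact: (cvg_unique _ i_l l_l).
Qed.

End Bochner.

Section BochnerExists.
Context {R : realType} {V : completeNormedModType R[i]}.
Local Notation RR := (measurableTypeR R).
Hypothesis Vnorming : @norming R V.

(** The simple functions that converge to [f] pointwise are cut down to 0 where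
    their norm exceeds twice that of [f].  They still converge pointwise, and
    their distance to [f] is now dominated by three times the norm of [f]. *)
Lemma is_bochner_integral_exists (D : set RR) (f : RR -> V) :
  measurable D -> (leb D < +oo)%E -> strongly_measurable D f ->
  Rintegrable D (fun t => rnorm (f t)) -> exists v, is_bochner_integral D f v.
Proof.
move=> mD Doo fm fi; have mf := measurable_rnorm mD fm.
have [s [ss sf]] := fm.
pose E n : set RR := D `&` [set t | rnorm (s n t) <= 2 * rnorm (f t)].
have mE n : measurable (E n).
  apply: measurable_fun_le => //; first exact: measurable_funTS (simple_measurable _ (ss n)).
  exact: measurable_funM.
pose s' n t := if t \in E n then s n t else 0.
have ss' n : simple_function (s' n) by apply: simple_if => //; exact: simple_cst.
have sf' t : D t -> s' n t @[n --> \oo] --> f t.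
  move=> Dt; have [f0|f0] := eqVneq (f t) 0.
    rewrite f0 (_ : (fun _ => _) = cst 0); first exact: cvg_cst.
    apply/funext => n; rewrite /s'; case: ifPn => // /set_mem[_ /=].
    rewrite f0 rnorm0 mulr0 => sle; apply: rnorm_eq0.
    by apply/eqP; rewrite eq_le sle rnorm_ge0.
  apply/cvg_rnormP => e e0.
  have f1 : 0 < rnorm (f t).
    rewrite lt_def rnorm_ge0 andbT; apply: contra_neq f0; exact: rnorm_eq0.
  have /cvg_rnormP sft := sf t Dt.
  apply: filterS2 (sft _ e0) (sft _ f1) => n h1 h2.
  rewrite /s' mem_set//; split => //=.
  by have := rnorm_dist (s n t) (f t); lra.
have s'le n t : D t -> rnorm (f t - s' n t) <= 3 * rnorm (f t).
  move=> Dt; rewrite (le_trans (rnormB_le _ _))// /s'; case: ifPn => [/set_mem[_ /=]|_].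
    by lra.
  by rewrite rnorm0; have := rnorm_ge0 (f t); lra.
have m' n : measurable_fun D (fun t => rnorm (f t - s' n t)).
  exact: measurable_rnormB_simple.
have i3 : Rintegrable D (fun t => 3 * rnorm (f t)) by exact: RintegrableZ.
have i' n : Rintegrable D (fun t => rnorm (f t - s' n t)).
  apply: Rintegrable_le i3 _ => // t Dt.
  by rewrite ger0_norm ?rnorm_ge0// s'le.
have [||_] := @Rdominated _ D (fun n t => rnorm (f t - s' n t)) (cst 0) _ mD m' _ i3 _.
- move=> t Dt; rewrite -(rnorm0 (V := V)) -(subrr (f t)).
  by apply: cvg_rnorm; apply: cvgB; [exact: cvg_cst|exact: sf'].
- by move=> n t Dt; rewrite ger0_norm ?rnorm_ge0// s'le.
rewrite Rintegral_cst// mul0r => I0.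
have w' n := simple_weak_integral mD Doo (ss' n).
have vd n m : rnorm (simple_integral D (s' n) - simple_integral D (s' m)) <=
    \int[leb]_(t in D) rnorm (f t - s' n t) + \int[leb]_(t in D) rnorm (f t - s' m t).
  rewrite -RintegralD//.
  apply: (weak_integral_le Vnorming mD (weak_integralB mD (w' n) (w' m))).
    exact: RintegrableD.
  move=> t Dt; rewrite (_ : s' n t - s' m t = (f t - s' m t) - (f t - s' n t)).
    by rewrite (le_trans (rnormB_le _ _))// addrC.
  by rewrite opprB [RHS]addrC addrA subrK.
have [|v sv] := @rnorm_cauchy _ _ (fun n => simple_integral D (s' n)).
  move=> e e0; have e2 : 0 < e / 2 by lra.
  move/cvgrPdist_lt: I0 => /(_ _ e2)[N _ hN]; exists N => n Nn.
  rewrite (le_lt_trans (vd _ _))//.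
  have := hN n Nn; have := hN N (leqnn N); rewrite /= !sub0r !normrN.
  by rewrite !ger0_norm ?Rintegral_ge0// => [|t _|t _]; rewrite ?rnorm_ge0//; lra.
exists v, s'; split => //.
rewrite (_ : (fun _ => _) = EFin \o (fun n => \int[leb]_(t in D) rnorm (f t - s' n t))).
  by apply: cvg_EFin => //; exact: nearW.
by apply/funext => n; rewrite /= /Rintegral fineK//; exact: integrable_fin_num (i' n).
Qed.

End BochnerExists.

(** * Integrals of continuous functions *)

Section ContinuousIntegrals.
Context {R : realType} {V : normedModType R[i]}.
Local Notation RR := (measurableTypeR R).
Implicit Types (f F : R -> V) (l : V -> R) (b : R).

(** The values of [f] at the left ends of the first [m] cells of mesh 1/n, as a
    recursion on [m] so that simplicity follows by induction. *)
Fixpoint step_function f (n m : nat) (t : R) : V :=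
  if m is m'.+1 then
    if t \in [set x : R | m'%:R / n%:R <= x < m'.+1%:R / n%:R]
    then f (m'%:R / n%:R) else step_function f n m' t
  else 0.

Lemma step_function_simple f n m : simple_function (step_function f n m).
Proof.
elim: m => [|m IH]; first exact: simple_cst.
have mE : measurable ([set x : R | m%:R / n%:R <= x < m.+1%:R / n%:R] : set RR).
  rewrite (_ : mkset _ = [set` `[m%:R / n%:R, m.+1%:R / n%:R[ ]).
    exact: measurable_itv.
  by apply/seteqP; split => x /=; rewrite in_itv.
exact: (simple_if mE (simple_cst _) IH).
Qed.

Lemma step_functionE f n m k t : (k < m)%N -> k%:R / n%:R <= t < k.+1%:R / n%:R ->
  step_function f n m t = f (k%:R / n%:R).
Proof.
move=> + kt; elim: m => // m IH; rewrite ltnS leq_eqVlt => /predU1P[<-|km] /=.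
  by rewrite mem_set.
case: ifPn => [/set_mem/= mt|_]; last exact: IH.
case/andP: kt => kt tk; case/andP: mt => mt _; exfalso.
have := le_lt_trans mt tk; case: n {IH kt tk mt} => [|n]; first by rewrite !invr0 !mulr0 ltxx.
by rewrite ltr_pM2r ?invr_gt0// ltr_nat ltnS leqNgt km.
Qed.

Lemma continuous_strongly_measurable f b : continuous f ->
  strongly_measurable `[0, b] f.
Proof.
move=> cf; exists (fun n => step_function f n.+1 (Num.truncn (b * n.+1%:R)).+1).
split; first by move=> n; exact: step_function_simple.
move=> t /=; rewrite in_itv/= => /andP[t0 tb].
pose k n := Num.truncn (t * n.+1%:R).
have n0 n : 0 < n.+1%:R :> R by rewrite ltr0n.
have kn n : (k n)%:R / n.+1%:R <= t < (k n).+1%:R / n.+1%:R.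
  rewrite ler_pdivrMr// ltr_pdivlMr//; apply: truncn_itv.
  by rewrite mulr_ge0// ltW.
have -> : (fun n => step_function f n.+1 (Num.truncn (b * n.+1%:R)).+1 t) =
    (fun n => f ((k n)%:R / n.+1%:R)).
  apply/funext => n; apply: step_functionE => //.
  by rewrite ltnS le_truncn// ler_wpM2r// ltW.
suff kt : (k n)%:R / n.+1%:R @[n --> \oo] --> t by exact: (cvg_comp _ _ kt (cf t)).
apply: (@cvg_dist_le _ _ (fun n => n.+1%:R^-1)); first exact: cvg_harmonic.
move=> n; have /andP[h1 h2] := kn n; rewrite distrC ger0_norm ?subr_ge0//.
by rewrite lerBlDl (le_trans (ltW h2))// -[in leLHS]natr1 mulrDl mul1r.
Qed.

Lemma itv_measure b : (lebesgue_measure (`[0%R, b]%classic : set RR) < +oo)%E.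
Proof. by rewrite lebesgue_measure_itv/=; case: ifP => _; rewrite ?ltry// -EFinD ltry. Qed.

Lemma continuous_rnorm f : continuous f -> continuous (fun t => rnorm (f t)).
Proof. by move=> cf t; apply: cvg_rnorm; exact: cf. Qed.

Lemma continuous_Rintegrable (g : R -> R) b : continuous g ->
  Rintegrable (`[0, b]%classic : set RR) g.
Proof.
move=> cg; apply: continuous_compact_integrable; first exact: segment_compact.
exact: continuous_subspaceT.
Qed.

Lemma FTC_real (F G : R -> R) b : 0 < b -> continuous F -> continuous G ->
  (forall t, 0 < t < b -> h^-1 * (F (t + h) - F t) @[h --> 0^'] --> G t) ->
  \int[leb]_(t in `[0, b]) G t = F b - F 0.
Proof.
move=> b0 cF cG dF.
have dF' t : 0 < t < b -> derivable F t 1 /\ 'D_1 F t = G t.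
  move=> /dF h; have h' : h^-1 *: (F (h *: 1 + t) - F t) @[h --> 0^'] --> G t.
    apply: cvg_trans h; apply: near_eq_cvg; near=> h.
    by rewrite [h%:A]mulr1 [h + t]addrC.
  split; first by apply/cvg_ex; exists (G t).
  exact: (cvg_lim _ h').
rewrite /Rintegral (@continuous_FTC2 _ G F)//.
- exact: continuous_subspaceT.
- split.
  + by move=> t; rewrite in_itv/= => /dF'[].
  + by apply: cvg_at_right_filter; exact: cF.
  + by apply: cvg_at_left_filter; exact: cF.
- by move=> t; rewrite in_itv/= derive1E => /dF'[].
Unshelve. all: by end_near. Qed.

Lemma weak_FTC (F G : R -> V) b : 0 <= b -> continuous F -> continuous G ->
  (forall t, 0 < t < b -> h^-1%:C *: (F (t + h) - F t) @[h --> 0^'] --> G t) ->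
  weak_integral `[0, b] G (F b - F 0).
Proof.
move=> b0 cF cG dF l hl.
have cl f : continuous f -> continuous (fun t => l (f t)).
  by move=> cf t; apply: rf_cvg => //; exact: cf.
split; first by apply: continuous_Rintegrable; exact: cl.
move: b0; rewrite le_eqVlt => /predU1P[<-|b0].
  by rewrite set_itv1 Rintegral_set1 subrr rf0.
rewrite (FTC_real b0 (cl _ cF)) ?rfB//; first exact: cl.
move=> t /dF h; under eq_fun do rewrite -rfB// -rfZ//.
exact: rf_cvg.
Qed.

End ContinuousIntegrals.

Section ContinuousBochner.
Context {R : realType} {V : completeNormedModType R[i]}.
Hypothesis Vnorming : @norming R V.

Lemma continuous_bochner (f : R -> V) (b : R) : continuous f ->
  exists v, is_bochner_integral `[0, b] f v.
Proof.
move=> cf; apply: (is_bochner_integral_exists Vnorming).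
- exact: measurable_itv.
- exact: itv_measure.
- exact: continuous_strongly_measurable.
- exact/continuous_Rintegrable/continuous_rnorm.
Qed.

End ContinuousBochner.

(** * Complex exponentials and their series *)

Section Modulus.
Context {R : realType}.
Implicit Types (c d : R[i]).

Definition cabs c : R := complex.Re `|c|.

Lemma cabsE c : `|c| = (cabs c)%:C.
Proof. by rewrite /cabs RRe_real// ger0_real. Qed.

Lemma cabsM c d : cabs (c * d) = cabs c * cabs d.
Proof. by apply: (@complexI R); rewrite rmorphM/= -!cabsE normrM. Qed.

Lemma cabsD c d : cabs (c + d) <= cabs c + cabs d.
Proof. by rewrite -lecR rmorphD/= -!cabsE ler_normD. Qed.

Lemma cabs_real (r : R) : cabs r%:C = `|r|.
Proof. exact: Re_normr. Qed.

Lemma cabsN c : cabs (- c) = cabs c.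
Proof. by rewrite /cabs normrN. Qed.

Lemma cabs_i (r : R) : cabs (0 +i* r) = `|r|.
Proof. by rewrite /cabs normc_def/= expr0n/= add0r sqrtr_sqr. Qed.

Lemma cabs_le (a b : R) : cabs (a +i* b) <= `|a| + `|b|.
Proof.
rewrite (_ : a +i* b = a%:C + (0 +i* b)); last by rewrite /= /GRing.add/= addr0 add0r.
by rewrite (le_trans (cabsD _ _))// cabs_real cabs_i.
Qed.

Lemma cabsX c n : cabs (c ^+ n) = cabs c ^+ n.
Proof.
elim: n => [|n IH]; last by rewrite !exprS cabsM IH.
by rewrite !expr0 /cabs normr1.
Qed.

Lemma rnormZc {V : normedModType R[i]} c (x : V) : rnorm (c *: x) = cabs c * rnorm x.
Proof. exact: rnormZ. Qed.

End Modulus.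

Section Cis.
Context {R : realType}.
Implicit Types (a b x y : R).

(** The mean value theorem in the form that turns a bound on the derivative
    into one on the function; applied repeatedly below, it gives the quadratic
    estimates for sine and cosine. *)
Lemma le_mean_value (f df : R -> R) (K x : R) : 0 <= x -> f 0 = 0 ->
  (forall c : R, is_derive c 1 f (df c)) ->
  (forall c, 0 <= c <= x -> `|df c| <= K) -> `|f x| <= K * x.
Proof.
move=> x0 f0 fd dK.
have [|c] := MVT_segment x0 (fun c _ => fd c).
  apply: continuous_subspaceT => c.
  by apply/differentiable_continuous/derivable1_diffP; case: (fd c).
rewrite in_itv/= => cx; rewrite f0 !subr0 => ->.
by rewrite normrM (ger0_norm x0) ler_wpM2r// dK.
Qed.

Lemma sin_le_abs x : `|sin x| <= `|x|.
Proof.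
wlog x0 : x / 0 <= x => [h|].
  have [/h//|/ltW x0] := leP 0 x.
  by have := h (- x); rewrite sinN !normrN oppr_ge0; exact.
rewrite (ger0_norm x0) -[leRHS]mul1r.
by apply: (@le_mean_value sin cos) => // [|c _]; [exact: sin0|exact: cos_max].
Qed.

Lemma cosB1_le_sqr x : `|cos x - 1| <= x ^+ 2.
Proof.
wlog x0 : x / 0 <= x => [h|].
  have [/h//|/ltW x0] := leP 0 x.
  by have := h (- x); rewrite cosN sqrrN oppr_ge0; exact.
rewrite expr2; apply: (@le_mean_value (fun y => cos y - 1) (fun y => - sin y)) => //.
- by rewrite cos0 subrr.
- by move=> c; rewrite -[- sin c]subr0; apply: is_deriveB.
- move=> c /andP[c0 cx]; rewrite normrN (le_trans (sin_le_abs c))//.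
  by rewrite ger0_norm.
Qed.

Lemma sinBid_le_sqr x : `|sin x - x| <= x ^+ 2.
Proof.
wlog x0 : x / 0 <= x => [h|].
  have [/h//|/ltW x0] := leP 0 x.
  by have := h (- x); rewrite sinN -opprD normrN sqrrN oppr_ge0; exact.
rewrite expr2; apply: (@le_mean_value (fun y => sin y - y) (fun y => cos y - 1)) => //.
- by rewrite sin0 subrr.
move=> c /andP[c0 cx].
apply: (@le_trans _ _ (1 * c)); last by rewrite mul1r.
apply: (@le_mean_value (fun y => cos y - 1) (fun y => - sin y)) => //.
- by rewrite cos0 subrr.
- by move=> d; rewrite -[- sin d]subr0; apply: is_deriveB.
- by move=> d _; rewrite normrN sin_max.
Qed.

Definition cis x : R[i] := cos x +i* sin x.

Lemma cisD x y : cis (x + y) = cis x * cis y.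
Proof.
rewrite /cis cosD sinD {3}/GRing.mul/=; congr (_ +i* _).
by rewrite addrC.
Qed.

Lemma cis0 : cis 0 = 1.
Proof. by rewrite /cis cos0 sin0. Qed.

Lemma cabs_cis x : cabs (cis x) = 1.
Proof. by rewrite /cabs normc_def/= cos2Dsin2 sqrtr1. Qed.

Lemma cis_quadratic x : cabs (cis x - 1 - (0 +i* x)) <= 2 * x ^+ 2.
Proof.
rewrite (_ : _ - _ = (cos x - 1) +i* (sin x - x)).
  rewrite (le_trans (cabs_le _ _))//.
  by have := cosB1_le_sqr x; have := sinBid_le_sqr x; lra.
by rewrite /cis {1 2}/GRing.add/= !oppr0 !addr0.
Qed.

Lemma cis2pi (n : int) : cis (2 * pi * n%:~R) = 1.
Proof.
have h (m : nat) : cis (2 * pi * m%:R) = 1.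
  elim: m => [|m IH]; first by rewrite mulr0 cis0.
  rewrite -[m.+1%:R]natr1 mulrDr mulr1 cisD IH mul1r /cis.
  by rewrite mulr_natl cos2pi sin2pi.
case: n => n; first exact: h.
rewrite NegzE mulrNz mulrN; have := h n.+1.
rewrite -[X in X = _ -> _]mul1r => /(congr1 (fun z => cis (- (2 * pi * n.+1%:R)) * z)).
by rewrite mulr1 mul1r -cisD addNr cis0 => <-.
Qed.

End Cis.

Section Waves.
Context {R : realType} {V : normedModType R[i]}.
Variable T : R.
Hypothesis T0 : 0 < T.

Definition freq (n : int) : R := 2 * pi * n%:~R / T.
Definition wave (n : int) (t : R) : R[i] := cis (freq n * t).

Lemma waveD n s t : wave n (s + t) = wave n s * wave n t.
Proof. by rewrite /wave mulrDr cisD. Qed.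

Lemma waveM n m t : wave n t * wave m t = wave (n + m) t.
Proof. rewrite /wave -cisD; congr cis; rewrite /freq intrD.
by field; rewrite gt_eqF. Qed.

Lemma wave_0 n : wave n 0 = 1.
Proof. by rewrite /wave mulr0 cis0. Qed.

Lemma wave0 t : wave 0 t = 1.
Proof. by rewrite /wave /freq mulr0 mul0r mul0r cis0. Qed.

Lemma cabs_wave n t : cabs (wave n t) = 1.
Proof. exact: cabs_cis. Qed.

Lemma wave_period n t : wave n (t + T) = wave n t.
Proof. by rewrite waveD {2}/wave /freq divfK ?gt_eqF// cis2pi mulr1. Qed.

Lemma continuous_cis : continuous (cis : R -> R[i]^o).
Proof.
move=> t; apply/cvg_rnormP => e e0; have e2 : 0 < e / 2 by lra.
have /cvgrPdist_lt/(_ _ e2) hc := @continuous_cos R t.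
have /cvgrPdist_lt/(_ _ e2) hs := @continuous_sin R t.
apply: filterS2 hc hs => s h1 h2.
rewrite -[rnorm _]/(cabs (cis s - cis t)).
rewrite (_ : _ - _ = (cos s - cos t) +i* (sin s - sin t)); last first.
  by rewrite /cis {1}/GRing.add/= .
by rewrite (le_lt_trans (cabs_le _ _))// distrC (distrC (sin s)); lra.
Qed.

Lemma continuous_wave n : continuous (wave n : R -> R[i]^o).
Proof.
move=> t; have h : freq n * s @[s --> t] --> freq n * t by apply: cvgMr; exact: cvg_id.
exact: (cvg_comp _ _ h (@continuous_cis _)).
Qed.

Lemma continuous_waveZ n (f : R -> V) : continuous f -> continuous (fun t => wave n t *: f t).
Proof. by move=> cf t; apply: cvgZ; [exact: continuous_wave|exact: cf]. Qed.

(** An explicit remainder, uniform in [t], instead of a mere limit: the sum of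
    these remainders over a series of waves is what differentiates the series.
    Its cost is the factor [freq n ^+ 2]. *)
Lemma wave_difference n (t h : R) (y : V) : h != 0 ->
  rnorm (h^-1%:C *: (wave n (t + h) *: y - wave n t *: y)
         - (0 +i* freq n) *: (wave n t *: y)) <= 2 * freq n ^+ 2 * `|h| * rnorm y.
Proof.
move=> h0.
have -> : h^-1%:C *: (wave n (t + h) *: y - wave n t *: y)
    - (0 +i* freq n) *: (wave n t *: y) =
    (wave n t * h^-1%:C * (cis (freq n * h) - 1 - (0 +i* (freq n * h)))) *: y.
  rewrite waveD -scalerBl !scalerA -scalerBl; congr (_ *: _).
  rewrite -{2}[wave n t]mulr1 -mulrBr -/(wave n h).
  have -> : (0 +i* (freq n * h)) = h%:C * (0 +i* freq n) :> R[i].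
    by rewrite {2}/GRing.mul/= !mul0r !mulr0 subr0 addr0 mulrC.
  have hh : h^-1%:C * h%:C = 1 :> R[i] by rewrite -rmorphM/= mulVf.
  rewrite [RHS]mulrBr; congr (_ - _); first by ring.
  rewrite (_ : _ * (h%:C * _) = (h^-1%:C * h%:C) * ((0 +i* freq n) * wave n t)); last by ring.
  by rewrite hh mul1r.
rewrite rnormZc !cabsM cabs_wave mul1r cabs_real ler_wpM2r ?rnorm_ge0//.
rewrite (le_trans (ler_wpM2l _ (cis_quadratic _)))// exprMn.
rewrite normfV -[h ^+ 2]real_normK ?num_real// le_eqVlt; apply/orP; left; apply/eqP.
by field; rewrite normr_eq0.
Qed.

Lemma has_deriv_wave n (y : V) :
  has_deriv (fun t => wave n t *: y) (fun t => (0 +i* freq n) *: (wave n t *: y)).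
Proof.
move=> t; apply/cvg_rnorm0.
have b0 : 2 * freq n ^+ 2 * `|h| * rnorm y @[h --> (0 : R)^'] --> (0 : R).
  rewrite -[X in _ --> X](mul0r (rnorm y)); apply: cvgMl.
  rewrite -[X in _ --> X](mulr0 (2 * freq n ^+ 2)); apply: cvgMr.
  rewrite -[X in _ --> X](@normr0 _ R).
  by apply: cvg_norm; exact: cvg_within.
apply: (squeeze_cvgr _ (cvg_cst 0) b0); near=> h.
rewrite rnorm_ge0 wave_difference//.
by near: h; exact: nbhs_dnbhs_neq.
Unshelve. all: by end_near. Qed.

(** Multiplying by a translate of the cosine shifts Fourier indices by 1 and
    -1, so it preserves the vanishing of all Fourier coefficients. *)
Lemma cos_wave m t :
  (cos (freq 1 * (t - m)))%:C =
  2^-1%:C * wave 1 (- m) * wave 1 t + 2^-1%:C * wave (-1) (- m) * wave (-1) t.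
Proof.
rewrite -!(mulrA 2^-1%:C) -!waveD -mulrDr (addrC (- m)) /wave.
rewrite (_ : freq (-1) = - freq 1); last by rewrite /freq mulrNz mulrN mulNr.
rewrite mulNr; set x := freq 1 * (t - m).
rewrite /cis cosN sinN; apply/eqP; rewrite eq_complex /=; apply/andP; split; apply/eqP.
  by field.
by field.
Qed.

End Waves.

Section Halving.
Context {R : realType}.

Lemma half_ge0 j : 0 <= 2^-1 ^+ j :> R.
Proof. by rewrite exprn_ge0// invr_ge0. Qed.

Lemma half_cvg0 (c : R) : c * 2^-1 ^+ N @[N --> \oo] --> 0.
Proof.
rewrite -[X in _ --> X](mulr0 c); apply: cvgMr.
by apply: cvg_expr; rewrite ger0_norm ?invr_ge0// invf_lt1// ltr1n.
Qed.

Lemma le_add_half (a b c : R) : (forall N, a <= b + c * 2^-1 ^+ N) -> a <= b.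
Proof.
move=> abc; have : b + c * 2^-1 ^+ N @[N --> \oo] --> b + 0.
  by apply: cvgD; [exact: cvg_cst|exact: half_cvg0].
by rewrite addr0 => /cvgr_to_ge; apply; exact: nearW.
Qed.

End Halving.

Section WaveSeries.
Context {R : realType} {V : completeNormedModType R[i]}.
Variables (T : R) (n : nat -> int) (y : nat -> V) (K : nat -> R).
Hypothesis T0 : 0 < T.
Hypothesis yK : forall p j, `|freq T (n j)| ^+ p * rnorm (y j) <= K p * 2^-1 ^+ j.

Let term p j (t : R) : V := (0 +i* freq T (n j)) ^+ p *: (wave T (n j) t *: y j).

(** Term-by-term differentiation.  For a fixed increment [h] the remainders of
    [wave_difference] sum up to a bound on the difference quotients of all
    partial sums, proportional to |h| and independent of their length [N].
    Letting [N] tend to infinity transfers it to the sum of the series. *)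
Lemma wave_series : exists d : nat -> R -> V,
  [/\ forall p t N, rnorm (d p t - \sum_(j < N)
        (0 +i* freq T (n j)) ^+ p *: (wave T (n j) t *: y j)) <= 2 * K p * 2^-1 ^+ N,
      forall p t, d p (t + T) = d p t
    & forall p, has_deriv (d p) (d p.+1)].
Proof.
have K0 p : 0 <= K p.
  by have := yK p 0; rewrite expr0 mulr1; apply: le_trans; rewrite mulr_ge0 ?rnorm_ge0.
have nterm p j t : rnorm (term p j t) = `|freq T (n j)| ^+ p * rnorm (y j).
  by rewrite /term !rnormZc cabsX cabs_i cabs_wave mul1r.
have /choice[d' d'E] : forall pt : nat * R, exists l : V, forall N,
    rnorm (l - \sum_(j < N) term pt.1 j pt.2) <= 2 * K pt.1 * 2^-1 ^+ N.
  move=> [p t] /=; apply: (@rnorm_series _ V (fun j => term p j t) (fun N => 2 * K p * 2^-1 ^+ N)) => //.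
    exact: half_cvg0.
    by move=> k; rewrite !mulr_ge0// half_ge0.
  move=> k; rewrite nterm (le_trans (yK p k))// exprS.
  by have := @half_ge0 R k; have := K0 p; lra.
pose d p t := d' (p, t).
have dE p t N : rnorm (d p t - \sum_(j < N) term p j t) <= 2 * K p * 2^-1 ^+ N.
  exact: (d'E (p, t)).
have sum_half N : \sum_(j < N) 2^-1 ^+ j <= 2 :> R.
  suff -> : \sum_(j < N) 2^-1 ^+ j = 2 - 2 * 2^-1 ^+ N :> R.
    by have := @half_ge0 R N; lra.
  elim: N => [|N IH]; first by rewrite big_ord0 expr0 mulr1 subrr.
  by rewrite big_ord_recr/= IH exprS; field.
exists d; split=> //.
  move=> p t; apply/eqP; rewrite -subr_eq0; apply/eqP/rnorm_eq0/eqP.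
  rewrite eq_le rnorm_ge0 andbT; apply: (@le_add_half _ _ _ (4 * K p)) => N; rewrite add0r.
  have h1 := dE p (t + T) N; have h2 := dE p t N.
  have E : \sum_(j < N) term p j (t + T) = \sum_(j < N) term p j t.
    by apply: eq_bigr => j _; rewrite /term wave_period.
  rewrite E in h1.
  have -> : d p (t + T) - d p t = (d p (t + T) - \sum_(j < N) term p j t) -
      (d p t - \sum_(j < N) term p j t) by rewrite opprB addrA subrK.
  by have := rnormB_le (d p (t + T) - \sum_(j < N) term p j t) (d p t - \sum_(j < N) term p j t); lra.
move=> p t; apply/cvg_rnorm0.
have q0 : 4 * K p.+2 * `|h| @[h --> (0 : R)^'] --> (0 : R).
  rewrite -[X in _ --> X](mulr0 (4 * K p.+2)); apply: cvgMr.
  rewrite -[X in _ --> X](@normr0 _ R).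
  by apply: cvg_norm; exact: cvg_within.
apply: (squeeze_cvgr _ (cvg_cst 0) q0); near=> h.
have h0 : h != 0 by near: h; exact: nbhs_dnbhs_neq.
rewrite rnorm_ge0/=.
apply: (@le_add_half _ _ _ (`|h|^-1 * (4 * K p) + 2 * K p.+1)) => N.
pose P q s := \sum_(j < N) term q j s.
(* The remainder has two more powers of the frequency, hence [K p.+2]. *)
have PE : rnorm (h^-1%:C *: (P p (t + h) - P p t) - P p.+1 t) <= 4 * K p.+2 * `|h|.
  rewrite /P -sumrB scaler_sumr -sumrB (le_trans (rnorm_sum _ _))//.
  apply: (@le_trans _ _ (\sum_(j < N) 2 * K p.+2 * `|h| * 2^-1 ^+ j)).
    apply: ler_sum => j _; rewrite /term -scalerBr exprSr.
    have gen (a b c : R[i]) (x z : V) :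
        a *: (b *: x) - (b * c) *: z = b *: (a *: x - c *: z).
      by rewrite scalerBr !scalerA (mulrC a).
    rewrite gen rnormZc cabsX cabs_i.
    rewrite (le_trans (ler_wpM2l _ (wave_difference _ _ _ _ h0)))// ?exprn_ge0//.
    move: (yK p.+2 j); move: (freq T (n j)) (rnorm (y j)) => w r hy.
    have := ler_wpM2l (normr_ge0 h) hy; rewrite -[w ^+ 2]real_normK ?num_real//.
    by rewrite !exprS expr0; lra.
  rewrite -mulr_sumr; have := sum_half N.
  have : 0 <= 2 * K p.+2 * `|h| by rewrite !mulr_ge0.
  move=> /ler_wpM2l/[apply]; lra.
have -> : h^-1%:C *: (d p (t + h) - d p t) - d p.+1 t =
    (h^-1%:C *: (P p (t + h) - P p t) - P p.+1 t) +
    (h^-1%:C *: ((d p (t + h) - P p (t + h)) - (d p t - P p t)) - (d p.+1 t - P p.+1 t)).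
  rewrite addrACA -scalerDr; congr (_ *: _ + _); last first.
    by rewrite -opprD addrC subrK.
  have gen2 (a b x z : V) : x - z = a - b + ((x - a) - (z - b)).
    by rewrite (opprD z) [x - a + _]addrACA -opprD [RHS]addrC subrK.
  exact: gen2.
apply: (le_trans (rnormD _ _)); rewrite lerD//.
apply: (le_trans (rnormB_le _ _)); rewrite mulrDl lerD//; last exact: dE.
rewrite rnormZr normfV -mulrA ler_wpM2l ?invr_ge0//.
apply: (le_trans (rnormB_le _ _)).
by have := dE p (t + h) N; have := dE p t N; rewrite -/(P _ _) -/(P _ _); lra.
Unshelve. all: by end_near. Qed.

End WaveSeries.

(** * Orbits of a bounded semigroup and mild solutions *)

Section NearZero.
Context {R : realType}.

Lemma dnbhs0I (P : R -> Prop) (d : R) : 0 < d ->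
  (forall h, h != 0 -> `|h| < d -> P h) -> \forall h \near 0^', P h.
Proof.
move=> d0 hP; exists d => //= h; rewrite /ball_/= sub0r normrN => hd h0.
exact: hP.
Qed.

Lemma right0E (P : R -> Prop) : (\forall h \near 0^'+, P h) ->
  exists2 d : R, 0 < d & forall h, 0 < h < d -> P h.
Proof.
move=> [d /= d0 hd]; exists d => // h /andP[h0 hlt]; apply: hd => //=.
by rewrite sub0r normrN gtr0_norm.
Qed.

Lemma dnbhs0E (P : R -> Prop) : (\forall h \near 0^', P h) ->
  exists2 d : R, 0 < d & forall h, h != 0 -> `|h| < d -> P h.
Proof.
move=> [d /= d0 hd]; exists d => // h h0 hlt; apply: hd => //=.
by rewrite sub0r normrN.
Qed.

Lemma nbhsE (x : R) (P : R -> Prop) : (\forall y \near x, P y) ->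
  exists2 d : R, 0 < d & forall y, `|y - x| < d -> P y.
Proof.
move=> [d /= d0 hd]; exists d => // y hy; apply: hd => //=.
by rewrite distrC.
Qed.

Lemma nbhsI (x : R) (P : R -> Prop) (d : R) : 0 < d ->
  (forall y, `|y - x| < d -> P y) -> \forall y \near x, P y.
Proof. by move=> d0 hP; exists d => //= y; rewrite /ball_/= distrC => /hP. Qed.

End NearZero.

Section Semigroups.
Context {R : realType} {H : normedModType R[i]}.
Variables (S : R -> {linear H -> H}) (M : R).
Hypothesis hS : C0_semigroup S.
Hypothesis M1 : 1 <= M.
Hypothesis SM : forall t x, 0 <= t -> rnorm (S t x) <= M * rnorm x.

Lemma M_ge0 : 0 <= M. Proof. exact: le_trans M1. Qed.

Lemma semi0 x : S 0 x = x. Proof. by case: hS. Qed.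

Lemma semiD s t x : 0 <= s -> 0 <= t -> S (s + t) x = S s (S t x).
Proof. by case: hS => _ _ h _; exact: h. Qed.

Lemma semiB t x y : S t (x - y) = S t x - S t y.
Proof. exact: linearB. Qed.

Lemma semiZ t (c : R[i]) x : S t (c *: x) = c *: S t x.
Proof. by rewrite linearZ. Qed.

Lemma semi_small (x : H) (e : R) : 0 < e ->
  exists2 d : R, 0 < d & forall h, 0 <= h < d -> rnorm (S h x - x) < e.
Proof.
move=> e0; case: hS => _ _ _ /(_ x)/cvg_rnormP/(_ _ e0)/right0E[d d0 hd].
exists d => // h /andP[]; rewrite le_eqVlt => /predU1P[<- _|h0 hlt].
  by rewrite semi0 subrr rnorm0.
by apply: hd; rewrite h0.
Qed.

Lemma semi_diff (x : H) (a b : R) : 0 <= a -> a <= b ->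
  rnorm (S b x - S a x) <= M * rnorm (S (b - a) x - x).
Proof.
move=> a0 ab; rewrite -[b in S b](subrKC a) semiD// ?subr_ge0// -linearB.
exact: SM.
Qed.

(** An increment of the orbit at any time is [S] at the earlier time applied to
    the increment at 0, so a uniform bound on [S] makes the strong continuity
    at 0 uniform in time. *)
Lemma semi_uniform (x : H) (e : R) : 0 < e ->
  exists2 d : R, 0 < d & forall a b, 0 <= a -> 0 <= b -> `|b - a| < d ->
    rnorm (S b x - S a x) < e.
Proof.
move=> e0; have M0 : 0 < M by exact: lt_le_trans M1.
have [d d0 hd] := semi_small x (divr_gt0 e0 M0); exists d => // a b.
wlog ab : a b / a <= b => [h a0 b0|a0 b0].
  have [/h|/ltW/h ba] := leP a b; first exact.
  by rewrite distrC rnormBC; exact: ba.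
rewrite ger0_norm ?subr_ge0// => hlt; apply: (le_lt_trans (semi_diff x a0 ab)).
by rewrite mulrC -ltr_pdivlMr//; apply: hd; rewrite subr_ge0 ab.
Qed.

(** The absolute value extends the integrand of the variation of constants
    formula continuously past s = t, so that it can be treated as a continuous
    function on the whole line. *)
Lemma continuous_orbit (f : R -> H) t : continuous f ->
  continuous (fun s => S `|t - s| (f s)).
Proof.
move=> cf s; apply/cvg_rnormP => e e0; have M0 : 0 < M by exact: lt_le_trans M1.
have e2 : 0 < e / 2 by rewrite divr_gt0.
have [d d0 hd] := semi_uniform (f s) e2.
have /cvg_rnormP/(_ _ (divr_gt0 e2 M0))/nbhsE[d' d'0 hd'] := cf s.
have dd : 0 < Num.min d d' by rewrite lt_min d0.
apply: (nbhsI dd) => r; rewrite lt_min => /andP[rd rd'].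
rewrite -(subrKA (S `|t - r| (f s))) -linearB.
rewrite (le_lt_trans (rnormD _ _))// [ltRHS](splitr e) ltrD//.
  rewrite (le_lt_trans (SM _ _))// mulrC -ltr_pdivlMr//; exact: hd'.
apply: hd => //; rewrite (le_lt_trans (ler_dist_dist _ _))//.
by rewrite opprD opprK addrACA subrr add0r addrC distrC.
Qed.

Section Generator.
Variables (DA : set H) (A : H -> H).
Hypothesis A_gen : generates DA A S.

(** The generator only gives the derivative from the right at time 0.  For
    negative [k] the quotient is [S (r + k)] applied to the right quotient of
    length [- k], and strong continuity lets [r + k] tend to [r]. *)
Lemma orbit_deriv (z : H) (r : R) : DA z -> 0 < r ->
  k^-1%:C *: (S `|r + k| z - S r z) @[k --> 0^'] --> S r (A z).
Proof.
move=> Dz r0; apply/cvg_rnormP => e e0; have M0 : 0 < M by exact: lt_le_trans M1.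
have e2 : 0 < e / 2 by rewrite divr_gt0.
have [/(_ (conj Dz erefl)) + _] := A_gen z (A z).
move=> /cvg_rnormP/(_ _ (divr_gt0 e2 M0))/right0E[d d0 hd].
have [d' d'0 hd'] := semi_uniform (A z) e2.
have dd : 0 < Num.min r (Num.min d d') by rewrite !lt_min r0 d0.
apply: (dnbhs0I dd) => k k0; rewrite !lt_min => /and3P[kr kd kd'].
have rk : 0 < r + k by have := ler_norm (- k); rewrite normrN; lra.
rewrite (gtr0_norm rk).
have [kp|kn] := ltP 0 k.
  rewrite semiD//; [|exact: ltW|exact: ltW].
  rewrite -linearB -linearZ/= -linearB.
  rewrite (le_lt_trans (SM _ (ltW r0)))// mulrC -ltr_pdivlMr//.
  have : e / 2 / M <= e / M by rewrite ler_pM2r ?invr_gt0//; lra.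
  by apply: lt_le_trans; apply: hd; rewrite kp/= -(gtr0_norm kp).
have {k0}kn : k < 0 by rewrite lt_neqAle k0.
have E : k^-1%:C *: (S (r + k) z - S r z) =
    S (r + k) ((- k)^-1%:C *: (S (- k) z - z)).
  have E2 : S (r + k) (S (- k) z) = S r z.
    by rewrite -semiD ?addrK//; [exact: ltW|rewrite oppr_ge0 ltW].
  by rewrite semiZ semiB E2 invrN rmorphN/= scaleNr -scalerN opprB.
rewrite E -(subrKA (S (r + k) (A z))) -linearB.
rewrite (le_lt_trans (rnormD _ _))// [ltRHS](splitr e) ltrD//.
  rewrite (le_lt_trans (SM _ (ltW rk)))// mulrC -ltr_pdivlMr//.
  by apply: hd; rewrite oppr_gt0 kn/= -(ltr0_norm kn).
by apply: hd' => //; rewrite ?ltW// addrAC subrr add0r.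
Qed.

Lemma continuous_waveZ1 T n (y : H) : continuous (fun s => wave T n s *: y).
Proof. by apply: continuous_waveZ => s; exact: cvg_cst. Qed.

(** The integrand is the derivative in s of S(t - s) (e_n(s) z): the generator
    contributes - S(t - s) (e_n(s) A z) and the wave contributes i omega_n
    times S(t - s) (e_n(s) z). *)
Lemma wave_response T n (y z : H) t : 0 <= t -> DA z ->
  (0 +i* freq T n) *: z - A z = y ->
  weak_integral `[0, t] (fun s => S `|t - s| (wave T n s *: y)) (wave T n t *: z - S t z).
Proof.
move=> t0 Dz zy.
pose F s := S `|t - s| (wave T n s *: z).
have -> : wave T n t *: z - S t z = F t - F 0.
  by rewrite /F subrr subr0 normr0 semi0 ger0_norm// wave_0 scale1r.
apply: weak_FTC => //; [exact/continuous_orbit/continuous_waveZ1..|].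
move=> s /andP[s0 st].
have r0 : 0 < t - s by rewrite subr_gt0.
rewrite -zy (gtr0_norm r0).
have -> : S (t - s) (wave T n s *: ((0 +i* freq T n) *: z - A z)) =
    S (t - s) ((0 +i* freq T n) *: (wave T n s *: z)) - wave T n s *: S (t - s) (A z).
  by rewrite scalerBr linearB/= !linearZ/= !scalerA [_ * wave _ _ _]mulrC.
(* The product rule, with the two increments separated. *)
have FE h : h^-1%:C *: (F (s + h) - F s) =
    S `|t - (s + h)| (h^-1%:C *: (wave T n (s + h) *: z - wave T n s *: z)) -
    wave T n s *: ((- h)^-1%:C *: (S `|(t - s) - h| z - S (t - s) z)).
  rewrite /F (gtr0_norm r0) opprD addrA.
  have E1 (c : R[i]) (P Q : H) : c *: ((- h)^-1%:C *: (P - Q)) =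
      - (h^-1%:C *: (c *: P - c *: Q)).
    rewrite invrN rmorphN/= scaleNr scalerN; congr (- _).
    by rewrite scalerA mulrC -scalerA scalerBr.
  rewrite E1 opprK !semiZ semiB !semiZ -scalerDr; congr (_ *: _).
  by rewrite addrA subrK.
under eq_fun do rewrite FE.
have hN : - h @[h --> (0 : R)^'] --> (0 : R)^'.
  move=> P /dnbhs0E[d d0 hd]; apply: (dnbhs0I d0) => h h0 hlt.
  by apply: hd; rewrite ?oppr_eq0 ?normrN.
apply: cvgB; last first.
  apply: cvgZr.
  have := @orbit_deriv z _ Dz r0.
  by move=> /(cvg_comp _ _ hN).
set w := wave T n s *: z; set w' := (0 +i* freq T n) *: w.
have dw : h^-1%:C *: (wave T n (s + h) *: z - w) @[h --> 0^'] --> w'.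
  exact: has_deriv_wave.
apply/cvg_rnormP => e e0; have M0 : 0 < M by exact: lt_le_trans M1.
have e2 : 0 < e / 2 by rewrite divr_gt0.
have [d d0 hd] := semi_uniform w' e2.
move/cvg_rnormP: dw => /(_ _ (divr_gt0 e2 M0))/dnbhs0E[d' d'0 hd'].
have dd : 0 < Num.min d d' by rewrite lt_min d0.
apply: (dnbhs0I dd) => h h0; rewrite lt_min => /andP[hd1 hd2].
rewrite -(subrKA (S `|t - (s + h)| w')) -linearB.
rewrite (le_lt_trans (rnormD _ _))// [ltRHS](splitr e) ltrD//.
  rewrite (le_lt_trans (SM _ _))// mulrC -ltr_pdivlMr//; exact: hd'.
apply: hd => //; first exact: ltW.
rewrite -(gtr0_norm r0) (le_lt_trans (ler_dist_dist _ _))//.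
by rewrite (_ : _ - _ = - h) ?normrN//; lra.
Qed.

End Generator.

End Semigroups.

Section MildSolutions.
Context {R : realType} {H : completeNormedModType R[i]}.
Local Notation RR := (measurableTypeR R).
Hypothesis Hnorming : @norming R H.
Variables (S : R -> {linear H -> H}) (M : R).
Hypothesis hS : C0_semigroup S.
Hypothesis M1 : 1 <= M.
Hypothesis SM : forall t x, 0 <= t -> rnorm (S t x) <= M * rnorm x.

Lemma eq_is_bochner_integral (D : set RR) (f g : R -> H) v :
  (forall t, D t -> f t = g t) -> is_bochner_integral D f v -> is_bochner_integral D g v.
Proof.
move=> fg [s [ss sf sI sv]]; exists s; split => //.
  by move=> t Dt; rewrite -fg//; exact: sf.
move: sI; under eq_fun do under eq_integral => t /set_mem Dt do rewrite fg//.
exact.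
Qed.

Lemma abs_forcing (f : R -> H) t s : (`[0, t]%classic : set R) s ->
  S `|t - s| (f s) = S (t - s) (f s).
Proof. by rewrite /= in_itv/= => /andP[_ st]; rewrite ger0_norm// subr_ge0. Qed.

Lemma mild_solution_weak (f u : R -> H) : mild_solution S f u -> exists u0, forall t, 0 <= t ->
  exists2 v, weak_integral `[0, t] (fun s => S `|t - s| (f s)) v & u t = S t u0 + v.
Proof.
move=> [u0 hu]; exists u0 => t t0; have [v [hv ->]] := hu t t0; exists v => //.
have mt : measurable (`[0, t]%classic : set RR) by exact: measurable_itv.
apply: eq_weak_integral (is_bochner_integral_weak mt (itv_measure t) hv) => // s ts.
by rewrite abs_forcing.
Qed.

Lemma zero_mild_solution (f : R -> H) : continuous f -> exists u, mild_solution S f u /\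
  forall t, 0 <= t -> weak_integral `[0, t] (fun s => S `|t - s| (f s)) (u t).
Proof.
move=> cf.
have /choice[u hu] : forall t, exists v, is_bochner_integral `[0, t] (fun s => S (t - s) (f s)) v.
  move=> t; have [v hv] := @continuous_bochner _ _ Hnorming _ t (@continuous_orbit _ _ S M hS M1 SM f t cf).
  by exists v; apply: eq_is_bochner_integral hv => s ts; rewrite abs_forcing.
exists u; split.
  by exists 0 => t _; exists (u t); split; [exact: hu|rewrite linear0 add0r].
move=> t t0; have mt : measurable (`[0, t]%classic : set RR) by exact: measurable_itv.
apply: eq_weak_integral (is_bochner_integral_weak mt (itv_measure t) (hu t)) => // s ts.
by rewrite abs_forcing.
Qed.

End MildSolutions.

(** * Resonance from resolvents of superpolynomial growth *)

Section Resonance.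
Context {R : realType} {H : completeNormedModType R[i]}.
Local Notation RR := (measurableTypeR R).
Hypothesis Hnorming : @norming R H.

Lemma leb_itv (b : R) : 0 <= b -> fine (lebesgue_measure (`[0, b]%classic : set RR)) = b.
Proof.
move=> b0; rewrite lebesgue_measure_itv/= lte_fin.
move: b0; rewrite le_eqVlt => /predU1P[<-|b0]; first by rewrite ltxx.
by rewrite b0/= oppr0 addr0.
Qed.

Lemma weak_integral_le_cst (f : R -> H) (v : H) (b c : R) : 0 <= b ->
  weak_integral `[0, b] f v -> (forall t, 0 <= t <= b -> rnorm (f t) <= c) ->
  rnorm v <= c * b.
Proof.
move=> b0 fv fc; rewrite -[X in _ * X](leb_itv b0).
rewrite -(@Rintegral_cst _ _ _ (@lebesgue_measure R) `[0, b]%classic (measurable_itv _)).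
apply: (weak_integral_le Hnorming _ fv) => //.
by apply: Rintegrable_cst => //; exact: itv_measure.
Qed.

Lemma has_deriv_continuous (f g : R -> H) : has_deriv f g -> continuous f.
Proof.
move=> fg t; apply/cvg_rnormP => e e0.
have /cvg_rnormP/(_ _ ltr01)/dnbhs0E[d d0 hd] := fg t.
have g1 : 0 < rnorm (g t) + 1 by have := rnorm_ge0 (g t); lra.
have d'0 : 0 < Num.min d (e / (rnorm (g t) + 1)) by rewrite lt_min d0 divr_gt0.
apply: (nbhsI d'0) => s; rewrite lt_min => /andP[sd].
have [->|st] := eqVneq s t; first by rewrite !subrr rnorm0.
rewrite ltr_pdivlMr// => se.
have st0 : s - t != 0 by rewrite subr_eq0.
have := hd _ st0 sd; rewrite subrKC => hq.
rewrite (_ : f s - f t = (s - t)%:C *: ((s - t)^-1%:C *: (f s - f t))); last first.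
  by rewrite scalerA -rmorphM/= divff// scale1r.
rewrite rnormZr (le_lt_trans _ se)// ler_wpM2l// ltW//.
have := rnorm_dist ((s - t)^-1%:C *: (f s - f t)) (g t); lra.
Qed.

Variables (S : R -> {linear H -> H}) (M : R).
Hypothesis hS : C0_semigroup S.
Hypothesis M1 : 1 <= M.
Hypothesis SM : forall t x, 0 <= t -> rnorm (S t x) <= M * rnorm x.
Hypothesis S_stable : strongly_stable S.
Variables (DA : set H) (A : H -> H).
Hypothesis A_gen : generates DA A S.
Variables (T : R) (T0 : 0 < T).
Variable B : int -> {linear H -> H}.
Hypothesis BE : forall n y, DA (B n y) /\ (0 +i* freq T n) *: B n y - A (B n y) = y.
Hypothesis B_large : forall (p : nat) (C : R), exists n y,
  C * (1 + `|freq T n|) ^+ p * rnorm y < rnorm (B n y).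

Let M0 : 0 <= M. Proof. exact: M_ge0 M1. Qed.

Definition response (t : R) (n : int) (y : H) : H :=
  wave T n t *: B n y - S t (B n y).

Lemma response_integral t n y : 0 <= t ->
  weak_integral `[0, t] (fun s => S `|t - s| (wave T n s *: y)) (response t n y).
Proof. by move=> t0; have [Dz zy] := BE n y; exact: (wave_response hS M1 SM A_gen). Qed.

Lemma response_le t n y : 0 <= t -> rnorm (response t n y) <= (1 + M) * rnorm (B n y).
Proof.
move=> t0; rewrite (le_trans (rnormB_le _ _))// mulrDl mul1r lerD// ?SM//.
by rewrite rnormZc cabs_wave mul1r.
Qed.

(** By the growth of the resolvents some [y0] has an image under [B n] that is
    larger than [y0] by any prescribed factor, powers of the frequency
    included.  Rescaled so that the image has norm L + j + 1, the vector [y] is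
    as small as required; at a late time [S t (B n y)] has norm below 1 and the
    response still has norm at least L + j. *)
Lemma hump (j : nat) (L tau : R) : 0 <= L -> 0 <= tau -> exists (n : int) (y : H) (t : R),
  [/\ (1 + `|freq T n|) ^+ j * rnorm y <= 2^-1 ^+ j,
      tau * M * rnorm y <= 2^-1 ^+ j, 0 <= t & L + j%:R <= rnorm (response t n y)].
Proof.
move=> L0 tau0; set a := L + j%:R + 1.
have a0 : 0 < a by rewrite /a; have := ler0n R j; lra.
have tM : 0 <= tau * M by rewrite mulr_ge0.
have [n [y0 By0]] := B_large j (a * 2 ^+ j * (1 + tau * M)).
set b := rnorm (B n y0) in By0.
have pj : 1 <= (1 + `|freq T n|) ^+ j by rewrite exprn_ege1// lerDl.
have C0 : 0 < a * 2 ^+ j * (1 + tau * M) by rewrite !mulr_gt0 ?exprn_gt0//; lra.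
have b0 : 0 < b.
  apply: le_lt_trans By0; rewrite !mulr_ge0 ?rnorm_ge0 ?exprn_ge0 ?(ltW a0)//; lra.
pose y := (a / b)%:C *: y0.
have ab0 : 0 <= a / b by rewrite divr_ge0 ?ltW.
have ny : rnorm y = a / b * rnorm y0 by rewrite rnormZr ger0_norm.
have nBy : rnorm (B n y) = a.
  by rewrite linearZ/= rnormZr ger0_norm// divfK// gt_eqF.
have key : (1 + `|freq T n|) ^+ j * rnorm y * (1 + tau * M) <= 2^-1 ^+ j.
  rewrite exprVn -[leRHS]mul1r ler_pdivlMr ?exprn_gt0//.
  rewrite ny -(ler_pM2r b0) mul1r (le_trans _ (ltW By0))// le_eqVlt.
  by apply/orP; left; apply/eqP; field; rewrite gt_eqF.
have r0 : 0 <= rnorm y := rnorm_ge0 _.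
have pr0 : rnorm y <= (1 + `|freq T n|) ^+ j * rnorm y by rewrite ler_peMl.
have /cvg_rnormP/(_ _ ltr01)[t [t0 ht]] := S_stable (B n y).
exists n, y, (Num.max 0 (t + 1)); split.
- apply: le_trans key; rewrite ler_peMr ?(le_trans r0)//; lra.
- apply: le_trans key; rewrite mulrDr mulr1 [tau * M * _]mulrC.
  by have := ler_wpM2r tM pr0; have := le_trans r0 pr0; lra.
- by rewrite le_max lexx.
- have := ht (Num.max 0 (t + 1)); rewrite lt_max ltrDl ltr01 orbT subr0 => /(_ isT) h.
  rewrite (le_trans _ (rnorm_dist _ _))// rnormZc cabs_wave mul1r nBy.
  by rewrite /a; lra.
Qed.

(** The recursion carries two numbers: a bound [L] on the responses to all the
    humps chosen so far, valid at every time, and the latest time [tau] at which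
    one of them was observed. *)
Lemma gliding_humps : exists (n : nat -> int) (y : nat -> H) (t : nat -> R),
  [/\ forall j, (1 + `|freq T (n j)|) ^+ j * rnorm (y j) <= 2^-1 ^+ j,
      forall i j, (i < j)%N -> t i * M * rnorm (y j) <= 2^-1 ^+ j,
      forall j, 0 <= t j
    & forall j, \sum_(i < j) (1 + M) * rnorm (B (n i) (y i)) + j%:R <=
        rnorm (response (t j) (n j) (y j))].
Proof.
have /choice[h hE] : forall x : nat * R * R, exists nyt : int * H * R,
    0 <= x.1.2 -> 0 <= x.2 ->
    [/\ (1 + `|freq T nyt.1.1|) ^+ x.1.1 * rnorm nyt.1.2 <= 2^-1 ^+ x.1.1,
      x.2 * M * rnorm nyt.1.2 <= 2^-1 ^+ x.1.1, 0 <= nyt.2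
    & x.1.2 + x.1.1%:R <= rnorm (response nyt.2 nyt.1.1 nyt.1.2)].
  move=> [[j L] tau] /=; have [[L0 tau0]|no] := pselect (0 <= L /\ 0 <= tau).
    by have [n [y [t ?]]] := hump j L0 tau0; exists (n, y, t).
  by exists (0, 0, 0) => L0 tau0; case: no.
pose next (j : nat) (s : R * R) : R * R :=
  let x := h (j, s.1, s.2) in
  (s.1 + (1 + M) * rnorm (B x.1.1 x.1.2), Num.max s.2 x.2).
pose st := fix st j := if j is k.+1 then next k (st k) else (0, 0).
pose x j := h (j, (st j).1, (st j).2).
have M10 : 0 <= 1 + M by rewrite addr_ge0.
have st0 j : 0 <= (st j).1 /\ 0 <= (st j).2.
  elim: j => [//|j [IH1 IH2]] /=; split; last by rewrite le_max IH2.
  by rewrite addr_ge0// mulr_ge0// rnorm_ge0.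
have xE j := hE (j, (st j).1, (st j).2) (st0 j).1 (st0 j).2.
have stE j : (st j).1 = \sum_(i < j) (1 + M) * rnorm (B (x i).1.1 (x i).1.2).
  by elim: j => [|j IH]; rewrite ?big_ord0// big_ord_recr/= -IH.
have stt i j : (i < j)%N -> (x i).2 <= (st j).2.
  elim: j => // j IH; rewrite ltnS leq_eqVlt => /predU1P[->|/IH ij] /=.
    by rewrite le_max lexx orbT.
  by rewrite le_max ij.
exists (fun j => (x j).1.1), (fun j => (x j).1.2), (fun j => (x j).2); split.
- by move=> j; case: (xE j).
- move=> i j ij; case: (xE j) => _ h2 _ _; apply: le_trans h2.
  by rewrite !ler_wpM2r ?rnorm_ge0//; exact: stt.
- by move=> j; case: (xE j).
- by move=> j; rewrite -stE; case: (xE j).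
Qed.

(** At the time [t j] the response to the first [j] humps is compensated by the
    excess of the next one, up to [j], and the later humps, being small in
    comparison with the length of the time interval, contribute at most 1. *)
Lemma resonant_forcing : exists f : R -> H,
  [/\ smooth_periodic T f, continuous f, exists K, forall t, rnorm (f t) <= K
    & forall K : R, exists2 t, 0 <= t & forall v,
        weak_integral `[0, t] (fun s => S `|t - s| (f s)) v -> K <= rnorm v].
Proof.
have [n [y [t [y1 y2 t0 yt]]]] := gliding_humps.
(* The decay of [y j] beats the p-th power of the frequency only from j = p
   on; the finitely many earlier terms are absorbed in the constant. *)
pose K p : R := 1 + \sum_(j < p) `|freq T (n j)| ^+ p * rnorm (y j) * 2 ^+ j.
have pos p j : 0 <= `|freq T (n j)| ^+ p * rnorm (y j) * 2 ^+ j.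
  by rewrite !mulr_ge0 ?exprn_ge0 ?rnorm_ge0.
have yK p j : `|freq T (n j)| ^+ p * rnorm (y j) <= K p * 2^-1 ^+ j.
  rewrite exprVn ler_pdivlMr ?exprn_gt0// /K.
  have [jp|pj] := ltnP j p.
    rewrite (bigD1 (Ordinal jp))//= addrCA lerDl addr_ge0// sumr_ge0// => i _.
  apply: (@le_trans _ _ 1); last by rewrite lerDl sumr_ge0// => i _; exact: pos.
  rewrite -ler_pdivlMr ?exprn_gt0// mul1r -exprVn (le_trans _ (y1 j))//.
  rewrite ler_wpM2r ?rnorm_ge0//.
  apply: (@le_trans _ _ ((1 + `|freq T (n j)|) ^+ p)).
    by rewrite lerXn2r ?nnegrE ?addr_ge0// lerDr.
  by rewrite ler_weXn2l// lerDl.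
have [d [dE dT dd]] := wave_series T0 yK.
have K0 : K 0%N = 1 by rewrite /K big_ord0 addr0.
pose P N s := \sum_(j < N) wave T (n j) s *: y j.
have fP s N : rnorm (d 0%N s - P N s) <= 2 * 2^-1 ^+ N.
  have := dE 0%N s N; rewrite K0 mulr1.
  by under eq_bigr do rewrite expr0 scale1r.
have cd : continuous (d 0%N) := has_deriv_continuous (dd 0%N).
exists (d 0%N); split => //.
- by split; [move=> s; exact: dT|exists d].
- exists 2 => s; have := fP s 0%N.
  by rewrite /P big_ord0 subr0 expr0 mulr1.
move=> k.
(* One unit above [k] for the later humps, one more for rounding. *)
pose j := (Num.truncn k).+2.
exists (t j) => // v fv.
have kj : k + 1 <= j%:R.
  have := truncnS_gt k; rewrite /j -[X in _ <= X]natr1; lra.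
(* The later humps. *)
have Mt : 0 <= t j * M by rewrite mulr_ge0.
have tail s : t j * M * rnorm (d 0%N s - P j.+1 s) <= 1.
  have blk m : t j * M * rnorm (P (j.+1 + m)%N s - P j.+1 s) <= 1 - 2^-1 ^+ m.
    elim: m => [|m IH]; first by rewrite addn0 subrr rnorm0 mulr0 expr0 subrr.
    rewrite addnS {1}/P big_ord_recr/= -/(P _ _) addrAC.
    have h1 := ler_wpM2l Mt (rnormD (P (j.+1 + m)%N s - P j.+1 s)
      (wave T (n (j.+1 + m)%N) s *: y (j.+1 + m)%N)).
    rewrite rnormZc cabs_wave mul1r mulrDr in h1.
    have h2 := y2 j (j.+1 + m)%N (leq_addr _ _).
    have h3 : 2^-1 ^+ (j.+1 + m) <= 2^-1 ^+ m.+1 :> R.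
      by apply: ler_wiXn2l; rewrite ?invr_ge0// ?invf_le1 ?ler1n// addSn ltnS leq_addl.
    by move: h3; rewrite [in X in _ <= X -> _]exprS; rewrite exprS; lra.
  apply: (@le_add_half _ _ _ (t j * M * 2)) => m.
  rewrite -(subrKA (P (j.+1 + m)%N s)).
  have h1 := ler_wpM2l Mt (rnormD (d 0%N s - P (j.+1 + m)%N s) (P (j.+1 + m)%N s - P j.+1 s)).
  have h2 := ler_wpM2l Mt (fP s (j.+1 + m)%N).
  have h3 : 2^-1 ^+ (j.+1 + m) <= 2^-1 ^+ m :> R.
    by apply: ler_wiXn2l; rewrite ?invr_ge0// ?invf_le1 ?ler1n// leq_addl.
  have h4 := ler_wpM2l Mt h3.
  rewrite mulrDr in h1; have := blk m; have := @half_ge0 R m; lra.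
have Pint : weak_integral `[0, t j] (fun s => S `|t j - s| (P j.+1 s))
    (\sum_(i < j.+1) response (t j) (n i) (y i)).
  have := @weak_integral_sum _ _ `[0, t j] j.+1
    (fun i s => S `|t j - s| (wave T (n i) s *: y i)) _ (measurable_itv _)
    (fun i => response_integral (n i) (y i) (t0 j)).
  by apply: eq_weak_integral => // s _; rewrite /P linear_sum.
have dv := weak_integralB (measurable_itv _) fv Pint.
have {}dv : rnorm (v - \sum_(i < j.+1) response (t j) (n i) (y i)) <= 1.
  have := t0 j; rewrite le_eqVlt => /predU1P[tj0|tj0].
    rewrite (le_trans (weak_integral_le_cst (c := M * 2) (t0 j) dv _)) -?tj0 ?mulr0//.
    move=> s _; rewrite -semiB (le_trans (SM _ _))// ler_wpM2l//.
    by rewrite (le_trans (fP s j.+1))// ler_piMr// exprn_ile1 ?invr_ge0// invf_le1// ler1n.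
  rewrite (le_trans (weak_integral_le_cst (c := (t j)^-1) (t0 j) dv _)) ?mulVf ?gt_eqF//.
  move=> s _; rewrite -semiB (le_trans (SM _ _))//.
  by rewrite -[leRHS]mul1r ler_pdivlMr// mulrC mulrA tail.
have : j%:R <= rnorm (\sum_(i < j.+1) response (t j) (n i) (y i)).
  rewrite big_ord_recr/= addrC -[X in _ + X]opprK.
  rewrite (le_trans _ (rnorm_dist _ _))// rnormN lerBrDr (le_trans _ (yt j))//.
  rewrite addrC lerD2r (le_trans (rnorm_sum _ _))//; apply: ler_sum => i _.
  exact: response_le.
have := rnorm_dist (\sum_(i < j.+1) response (t j) (n i) (y i)) v.
by rewrite rnormBC; lra.
Qed.

End Resonance.

(** * Uniqueness of Fourier coefficients *)

Section DominatedFinite.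
Context {R : realType}.
Local Notation RR := (measurableTypeR R).

Lemma Rdominated_finite (D : set RR) (f_ : nat -> RR -> R) (f g : RR -> R) (N : set R) :
  measurable D -> finite_set N ->
  (forall n, measurable_fun D (f_ n)) -> measurable_fun D f ->
  (forall t, D t -> ~ N t -> f_ n t @[n --> \oo] --> f t) ->
  Rintegrable D g -> (forall n t, D t -> `|f_ n t| <= g t) ->
  \int[leb]_(t in D) f_ n t @[n --> \oo] --> \int[leb]_(t in D) f t.
Proof.
move=> mD fN mf_ mf f_f ig f_g.
have mN : measurable (N : set RR).
  by apply: countable_measurable; [move=> t; exact: measurable_set1|exact: finite_set_countable].
have N0 : lebesgue_measure (N : set RR) = 0%E.
  by apply: countable_lebesgue_measure0; exact: finite_set_countable.
have [] := @dominated_convergence _ _ _ (@lebesgue_measure R) D mD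
  (fun n => EFin \o f_ n) (EFin \o f) (EFin \o g).
- by move=> n; exact/measurable_EFinP.
- exact/measurable_EFinP.
- exists N; split => // t /=; apply: contra_notP => Nt Dt.
  by apply: cvg_EFin; [exact: nearW|exact: f_f].
- exact: ig.
- by apply: aeW => t n Dt; rewrite lee_fin f_g.
move=> fi _ fcvg; apply: fine_cvg; rewrite fineK; first exact: fcvg.
exact: integrable_fin_num.
Qed.

Lemma Rintegrable_restrict (D E : set RR) (f : RR -> R) : measurable D ->
  measurable E -> E `<=` D -> Rintegrable E f -> Rintegrable D (f \_ E).
Proof.
move=> mD mE ED fi; rewrite -restrict_EFin; apply/integrable_restrict => //.
by rewrite setIidr.
Qed.

Lemma Rintegral_restrict (D E : set RR) (f : RR -> R) : E `<=` D ->
  \int[leb]_(t in D) (f \_ E) t = \int[leb]_(t in E) f t.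
Proof. by move=> ED; rewrite -Rintegral_mkcondr setIidr. Qed.

End DominatedFinite.

Section Threshold.
Context {R : realType}.
Implicit Types (x z al : R) (N k : nat).

Lemma bernoulli_sub x N : 0 <= x <= 1 -> 1 - N%:R * x <= (1 - x) ^+ N.
Proof.
move=> /andP[x0 x1]; elim: N => [|N IH]; first by rewrite mul0r subr0 expr0.
have y0 : 0 <= 1 - x by rewrite subr_ge0.
rewrite exprSr (le_trans _ (ler_wpM2r y0 IH))// -natr1.
have : 0 <= N%:R * (x * x) by rewrite mulr_ge0// mulr_ge0.
lra.
Qed.

Lemma bernoulli_add x N : 0 <= x -> 1 + N%:R * x <= (1 + x) ^+ N.
Proof.
move=> x0; elim: N => [|N IH]; first by rewrite mul0r addr0 expr0.
have y0 : 0 <= 1 + x by rewrite addr_ge0.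
rewrite exprSr (le_trans _ (ler_wpM2r y0 IH))// -natr1.
have : 0 <= N%:R * (x * x) by rewrite mulr_ge0// mulr_ge0.
lra.
Qed.

(** Polynomials in z that tend to 1 for z < 1/al and to 0 for z > 1/al: with an
    exponent N close to al^k, the power (1 - z^k)^N behaves like
    exp(- (al z)^k). *)
Definition threshold_exp al k : nat := (Num.truncn (al ^+ k)).+1.
Definition threshold al k z : R := (1 - z ^+ k) ^+ threshold_exp al k.

Lemma threshold_exp_ge al k : al ^+ k <= (threshold_exp al k)%:R.
Proof. exact/ltW/truncnS_gt. Qed.

Lemma threshold_exp_le al k : 0 <= al -> (threshold_exp al k)%:R <= al ^+ k + 1.
Proof. by move=> al0; rewrite -natr1 lerD2r truncn_le exprn_ge0. Qed.

Lemma threshold_bound al k z : 0 <= z <= 1 -> 0 <= threshold al k z <= 1.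
Proof.
move=> /andP[z0 z1]; have zk : 0 <= 1 - z ^+ k by rewrite subr_ge0 exprn_ile1.
by rewrite exprn_ge0// exprn_ile1// lerBlDr lerDl exprn_ge0.
Qed.

Lemma threshold_cvg1 al z : 1 < al -> 0 <= z <= 1 -> al * z < 1 ->
  threshold al k z @[k --> \oo] --> (1 : R).
Proof.
move=> al1 /andP[z0 z1] alz; have al0 : 0 <= al by lra.
have zlt1 : z < 1 by apply: le_lt_trans alz; rewrite ler_peMl// ltW.
apply: (@cvg_dist_le _ _ (fun k => (al * z) ^+ k + z ^+ k)).
  rewrite -[X in _ --> X]addr0; apply: cvgD.
    by apply: cvg_expr; rewrite ger0_norm// mulr_ge0.
  by apply: cvg_expr; rewrite ger0_norm.
move=> k; have zk0 : 0 <= z ^+ k by rewrite exprn_ge0.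
have zk1 : z ^+ k <= 1 by rewrite exprn_ile1.
have /andP[_ h1] := @threshold_bound al k z (introT andP (conj z0 z1)).
rewrite ler0_norm ?subr_le0// opprB lerBlDr.
have := @bernoulli_sub (z ^+ k) (threshold_exp al k) (introT andP (conj zk0 zk1)).
have := ler_wpM2r zk0 (threshold_exp_le k al0).
rewrite exprMn /threshold; lra.
Qed.

Lemma threshold_cvg0 al z : 1 < al -> 0 <= z <= 1 -> 1 < al * z ->
  threshold al k z @[k --> \oo] --> (0 : R).
Proof.
move=> al1 /andP[z0 z1] alz; have al0 : 0 < al by lra.
have zgt0 : 0 < z by rewrite -(pmulr_rgt0 _ al0) (lt_trans _ alz).
have az0 : 0 < al * z by lra.
apply: (@cvg_dist_le _ _ (fun k => (al * z)^-1 ^+ k)).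
  by apply: cvg_expr; rewrite ger0_norm ?invr_ge0 ?(ltW az0)// invf_lt1.
move=> k; have zk0 : 0 <= z ^+ k by rewrite exprn_ge0.
have zk1 : z ^+ k <= 1 by rewrite exprn_ile1.
have /andP[h0 h1] := @threshold_bound al k z (introT andP (conj z0 z1)).
rewrite subr0 ger0_norm// exprVn -[leRHS]mul1r ler_pdivlMr ?exprn_gt0//.
set N := threshold_exp al k.
have : threshold al k z * (1 + z ^+ k) ^+ N <= 1.
  rewrite /threshold -exprMn exprn_ile1//.
    by rewrite mulr_ge0// ?subr_ge0// addr_ge0.
  have : 0 <= z ^+ k * z ^+ k by rewrite mulr_ge0.
  lra.
apply: le_trans; rewrite ler_wpM2l// (le_trans _ (bernoulli_add _ zk0))//.
rewrite exprMn.
have := ler_wpM2r zk0 (threshold_exp_ge al k); rewrite -/N; lra.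
Qed.

End Threshold.

Section FourierUniqueness.
Context {R : realType} {V : normedModType R[i]}.
Local Notation RR := (measurableTypeR R).
Variables (T : R) (w : R -> V).
Hypothesis T0 : 0 < T.
Hypothesis w_coef : forall n, weak_integral `[0, T] (fun t => wave T n t *: w t) 0.

Let D : set RR := `[0, T]%classic.
Let mD : measurable D. Proof. exact: measurable_itv. Qed.

Lemma zero_coef_wave_integrable l n : real_functional l ->
  Rintegrable D (fun t => l (wave T n t *: w t)).
Proof. by move=> hl; exact: (w_coef n hl).1. Qed.

Lemma zero_coef_integrable l : real_functional l -> Rintegrable D (fun t => l (w t)).
Proof.
move=> hl; apply: eq_Rintegrable (zero_coef_wave_integrable 0 hl) => // t _.
by rewrite wave0 scale1r.
Qed.

(** Functions by which [w] may be multiplied without creating a nonzero Fourier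
    coefficient.  Demanding this of every index makes the class stable under
    multiplication by cosines, hence by trigonometric polynomials. *)
Definition annihilated (phi : R -> R) : Prop :=
  [/\ continuous phi, exists K : R, forall t, `|phi t| <= K
    & forall l n, real_functional l ->
        \int[leb]_(t in D) (phi t * l (wave T n t *: w t)) = 0].

Lemma bounded_mul_integrable (phi g : R -> R) : continuous phi ->
  (exists K : R, forall t, `|phi t| <= K) -> Rintegrable D g ->
  Rintegrable D (fun t => phi t * g t).
Proof.
move=> cphi [K phiK] ig.
apply: (@Rintegrable_le _ _ _ (fun t => K * `|g t|)) => //.
- apply: measurable_funM; last exact: Rintegrable_measurable.
  apply: measurable_funTS; exact: continuous_measurable_fun.
- by apply: RintegrableZ => //; exact: Rintegrable_norm.
- by move=> t _; rewrite normrM ler_wpM2r.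
Qed.

Lemma annihilated_integrable phi l n : annihilated phi -> real_functional l ->
  Rintegrable D (fun t => phi t * l (wave T n t *: w t)).
Proof. by move=> [cphi bphi _] hl; apply: bounded_mul_integrable => //; exact: zero_coef_wave_integrable. Qed.

Lemma annihilated1 : annihilated (cst 1).
Proof.
split; [by move=> t; exact: cvg_cst|by exists 1 => t; rewrite normr1|].
move=> l n hl; under eq_Rintegral do rewrite mul1r.
by have := (w_coef n hl).2; rewrite rf0.
Qed.

Lemma annihilated_lin (a b : R) phi psi : annihilated phi -> annihilated psi ->
  annihilated (fun t => a * phi t + b * psi t).
Proof.
move=> gphi gpsi; have [c1 [K1 h1] i1] := gphi; have [c2 [K2 h2] i2] := gpsi; split.
- by move=> t; apply: cvgD; apply: cvgMr; [exact: c1|exact: c2].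
- exists (`|a| * K1 + `|b| * K2) => t; rewrite (le_trans (ler_normD _ _))//.
  by rewrite !normrM lerD// ler_wpM2l.
move=> l n hl; have j1 := annihilated_integrable n gphi hl.
have j2 := annihilated_integrable n gpsi hl.
under eq_Rintegral do rewrite mulrDl -!mulrA.
rewrite RintegralD//; [|exact: RintegrableZ|exact: RintegrableZ].
by rewrite !RintegralZl// i1// i2// !mulr0 addr0.
Qed.

Lemma annihilated_cos m phi : annihilated phi ->
  annihilated (fun t => phi t * cos (freq T 1 * (t - m))).
Proof.
move=> gphi; have [c1 [K h] i1] := gphi; split.
- move=> t; apply: cvgM; first exact: c1.
  have h1 : freq T 1 * (s - m) @[s --> t] --> freq T 1 * (t - m).
    by apply: cvgMr; apply: cvgB; [exact: cvg_id|exact: cvg_cst].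
  exact: (cvg_comp _ _ h1 (@continuous_cos R _)).
- exists K => t; rewrite normrM -[leRHS]mulr1 ler_pM// ?cos_max//.
move=> l n hl.
pose c1' := 2^-1%:C * wave T 1 (- m); pose c2' := 2^-1%:C * wave T (-1) (- m).
have E t : phi t * cos (freq T 1 * (t - m)) * l (wave T n t *: w t) =
    phi t * l (c1' *: (wave T (1 + n) t *: w t)) +
    phi t * l (c2' *: (wave T (-1 + n) t *: w t)).
  rewrite -mulrA -mulrDr; congr (_ * _); rewrite -rfZ// -rfD//; congr l.
  rewrite cos_wave -(waveM T0 1 n) -(waveM T0 (-1) n) !scalerA -scalerDl; congr (_ *: _).
  by rewrite /c1' /c2'; ring.
under eq_Rintegral do rewrite E.
rewrite RintegralD//.
- by rewrite (i1 _ (1 + n) (rf_scale hl c1')) (i1 _ (-1 + n) (rf_scale hl c2')) addr0.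
- exact: (annihilated_integrable (1 + n) gphi (rf_scale hl c1')).
- exact: (annihilated_integrable (-1 + n) gphi (rf_scale hl c2')).
Qed.

(** The square of the sine of pi (t - m) / T.  On the circle it increases with
    the distance to [m], so its sublevel sets are the arcs centred at [m]. *)
Definition bump m t : R := (1 - cos (freq T 1 * (t - m))) / 2.

Lemma bump_bound m t : 0 <= bump m t <= 1.
Proof.
have := cos_le1 (freq T 1 * (t - m)); have := cos_geN1 (freq T 1 * (t - m)).
by rewrite /bump => h1 h2; apply/andP; split; lra.
Qed.

Lemma annihilated_bump m phi : annihilated phi -> annihilated (fun t => phi t * bump m t).
Proof.
move=> gphi; have := annihilated_lin 2^-1 (- 2^-1) gphi (annihilated_cos m gphi).
congr annihilated; apply/funext => t; rewrite /bump; by field.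
Qed.

Lemma annihilated_bumpX m k phi : annihilated phi ->
  annihilated (fun t => phi t * bump m t ^+ k).
Proof.
move=> gphi; elim: k => [|k IH].
  by move: gphi; congr annihilated; apply/funext => t; rewrite expr0 mulr1.
have := annihilated_bump m IH.
by congr annihilated; apply/funext => t; rewrite exprSr mulrA.
Qed.

Lemma annihilated_threshold m al k : annihilated (fun t => threshold al k (bump m t)).
Proof.
rewrite /threshold; elim: (threshold_exp al k) => [|N IH].
  by have := annihilated1; congr annihilated; apply/funext => t; rewrite expr0.
have := annihilated_lin 1 (-1) IH (annihilated_bumpX m k IH).
by congr annihilated; apply/funext => t; rewrite exprSr; ring.
Qed.

Let freq1T : freq T 1 * T = 2 * pi.
Proof. by rewrite /freq mulr1 divfK// gt_eqF. Qed.

Let freq1_gt0 : 0 < freq T 1.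
Proof. by rewrite /freq mulr1 divr_gt0// mulr_gt0// pi_gt0. Qed.

Lemma cos_abs_lt (x y : R) : `|x| < `|y| -> `|y| <= pi -> cos y < cos x.
Proof.
move=> xy ypi; rewrite -(cos_norm x) -(cos_norm y) ltr_cos// in_itv/= normr_ge0//=.
by rewrite (le_trans (ltW xy)).
Qed.

Lemma cos_wrap_lt (x y : R) : `|y| < `|x| -> `|x| < 2 * pi - `|y| -> `|y| <= pi ->
  cos x < cos y.
Proof.
move=> yx xy ypi; have [xpi|xpi] := leP `|x| pi; first exact: cos_abs_lt.
rewrite -(cos_norm x) -[cos `|x|]cosN -(cosD2pi (- `|x|)) -mulr_natl.
have e : `|- `|x| + 2 * pi| = 2 * pi - `|x|.
  have p0 : 0 <= - `|x| + 2 * pi by have := normr_ge0 y; lra.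
  by rewrite (ger0_norm p0) addrC.
by apply: cos_abs_lt; rewrite e; lra.
Qed.

Lemma bump_lt m s t : cos (freq T 1 * (s - m)) < cos (freq T 1 * (t - m)) ->
  bump m t < bump m s.
Proof. by rewrite /bump => h; lra. Qed.

Let half_angle a b : a < b -> b - a < T ->
  `|freq T 1 * (a - (a + b) / 2)| = freq T 1 * ((b - a) / 2) /\
  freq T 1 * ((b - a) / 2) < pi.
Proof.
move=> ab baT; split.
  by rewrite normrM gtr0_norm// ler0_norm; [congr (_ * _); lra|lra].
have : freq T 1 * (b - a) < freq T 1 * T by rewrite ltr_pM2l.
rewrite freq1T; lra.
Qed.

Lemma bump_inside a b t : b - a < T -> a < t < b ->
  bump ((a + b) / 2) t < bump ((a + b) / 2) a.
Proof.
move=> baT /andP[at_ tb]; have ab := lt_trans at_ tb.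
have [h1 h2] := half_angle ab baT; apply/bump_lt/cos_abs_lt; rewrite h1 ?ltW//.
by rewrite normrM gtr0_norm// ltr_pM2l// ltr_norml; apply/andP; split; lra.
Qed.

Lemma bump_outside a b t : 0 <= a -> a < b -> b <= T -> b - a < T ->
  0 < t < a \/ b < t < T ->
  bump ((a + b) / 2) a < bump ((a + b) / 2) t.
Proof.
move=> a0 ab bT baT ht; have [h1 h2] := half_angle ab baT.
have [g1 g2] : (b - a) / 2 < `|t - (a + b) / 2| /\
    `|t - (a + b) / 2| < T - (b - a) / 2.
  by case: ht => /andP[u1 u2]; [rewrite ltr0_norm|rewrite gtr0_norm]; lra.
apply/bump_lt/cos_wrap_lt; rewrite h1 ?ltW// normrM gtr0_norm// -?freq1T -?mulrBr;
  by rewrite ltr_pM2l.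
Qed.

Lemma bump_end a b : a < b -> b - a < T -> 0 < bump ((a + b) / 2) a < 1.
Proof.
move=> ab baT; have [h1 h2] := half_angle ab baT.
have p0 : 0 < freq T 1 * ((b - a) / 2) by rewrite mulr_gt0//; lra.
have c1 : cos (freq T 1 * (a - (a + b) / 2)) < 1.
  have : cos (freq T 1 * (a - (a + b) / 2)) < cos 0.
    by apply: cos_abs_lt; rewrite h1 ?normr0// ltW.
  by rewrite cos0.
have c2 : -1 < cos (freq T 1 * (a - (a + b) / 2)).
  have : cos pi < cos (freq T 1 * (a - (a + b) / 2)).
    by apply: cos_abs_lt; rewrite ?h1 gtr0_norm ?pi_gt0.
  by rewrite cospi.
by rewrite /bump; apply/andP; split; lra.
Qed.

(** The arc from [a] to [b] is a sublevel set of the bump at its midpoint, and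
    the threshold polynomials at the level of the end points converge to its
    indicator function except at the end points and at the ends of the period.
    Each of them annihilates [w], so dominated convergence concludes.  This
    is the completeness of the trigonometric system, in the form used below. *)
Lemma interval_integral0 a b : 0 <= a -> a < b -> b <= T -> b - a < T ->
  forall l, real_functional l -> \int[leb]_(t in `[a, b[) l (w t) = 0.
Proof.
move=> a0 ab bT baT l hl; pose m := (a + b) / 2.
have /andP[z0 z1] := bump_end ab baT; rewrite -/m in z0 z1.
pose al := (bump m a)^-1.
have al1 : 1 < al by rewrite /al invf_gt1.
have al0 : 0 < al by lra.
pose E : set RR := `[a, b[%classic.
have ED : E `<=` D.
  move=> t; rewrite /E /D/= !in_itv/= => /andP[at_ tb].
  by rewrite (le_trans a0)//= ltW// (lt_le_trans tb).
have mE : measurable E by exact: measurable_itv.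
have ilD := zero_coef_integrable hl.
have ilE : Rintegrable E (fun t => l (w t)) by exact: integrableS ilD.
have g k := annihilated_threshold m al k.
have := @Rdominated_finite _ D (fun k t => threshold al k (bump m t) * l (w t))
  ((fun t => l (w t)) \_ E) (fun t => `|l (w t)|) [set x | x \in [:: 0; a; b; T]] mD _ _ _ _
  (Rintegrable_norm mD ilD) _.
rewrite Rintegral_restrict// => h.
have I0 k : \int[leb]_(t in D) (threshold al k (bump m t) * l (w t)) = 0.
  have [_ _ /(_ l 0 hl) <-] := g k; apply: eq_Rintegral => t _.
  by rewrite wave0 scale1r.
have {h} : (0 : R) @[k --> \oo] --> \int[leb]_(t in E) l (w t).
  rewrite (_ : (fun _ => 0) =
      (fun k => \int[leb]_(t in D) (threshold al k (bump m t) * l (w t)))).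
    apply: h.
    - exact: finite_seq.
    - move=> k; apply: Rintegrable_measurable.
      by have [c1 c2 _] := g k; exact: bounded_mul_integrable.
    - by apply: Rintegrable_measurable; exact: Rintegrable_restrict.
    - move=> t Dt; rewrite /= !inE => /negP; rewrite !negb_or => /and4P[t0 ta tb tT].
      move: Dt; rewrite /D/= in_itv/= => /andP[t0' tT'].
      have {t0 t0'}t0 : 0 < t by rewrite lt_neqAle eq_sym t0.
      have {tT tT'}tT : t < T by rewrite lt_neqAle tT.
      have [tE|tE] := boolP (t \in E).
        rewrite patchE tE -[X in _ --> X]mul1r; apply: cvgMl.
        apply: threshold_cvg1 => //; first exact: bump_bound.
        rewrite mulrC -ltr_pdivlMr// mul1r invrK; apply: bump_inside => //.
        move: tE => /set_mem; rewrite /E/= in_itv/= => /andP[at_ ->].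
        by rewrite lt_neqAle eq_sym ta at_.
      rewrite patchE (negbTE tE) -[X in _ --> X](mul0r (l (w t))); apply: cvgMl.
      apply: threshold_cvg0 => //; first exact: bump_bound.
      rewrite mulrC -ltr_pdivrMr// mul1r invrK; apply: bump_outside => //.
      move: tE => /negP; rewrite inE /E/= in_itv/= => /negP; rewrite negb_and -ltNge -leNgt.
      case/orP => [h|h]; first by left; rewrite t0.
      by right; rewrite tT lt_neqAle eq_sym tb h.
    - move=> k t _; rewrite normrM ger0_norm; last first.
        by have /andP[] := threshold_bound al k (bump_bound m t).
      by rewrite ler_piMl//; have /andP[] := threshold_bound al k (bump_bound m t).
  by apply/funext => k; rewrite I0.
by move=> h; exact: (cvg_unique _ h (cvg_cst _)).
Qed.

End FourierUniqueness.

(** * Forcings without Fourier coefficients do not act *)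

Section OrbitIntegral.
Context {R : realType} {H : normedModType R[i]}.
Local Notation RR := (measurableTypeR R).
Variables (S : R -> {linear H -> H}) (M : R).
Hypothesis hS : C0_semigroup S.
Hypothesis M1 : 1 <= M.
Hypothesis SM : forall t x, 0 <= t -> rnorm (S t x) <= M * rnorm x.
Variables (T : R) (w : R -> H) (G : R -> R).
Hypothesis T0 : 0 < T.

Let D : set RR := `[0, T]%classic.
Let mD : measurable D. Proof. exact: measurable_itv. Qed.

Hypothesis w0 : forall a b, 0 <= a -> a < b -> b <= T -> b - a < T ->
  forall l, real_functional l -> \int[leb]_(t in `[a, b[) l (w t) = 0.
Hypothesis w_int : forall l, real_functional l -> Rintegrable D (fun t => l (w t)).
Hypothesis G_int : Rintegrable D G.
Hypothesis wG : forall t, D t -> rnorm (w t) <= G t.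

(* At least two cells, because only intervals shorter than the period are known
   to carry no mass. *)
Let node (n : nat) (j : nat) : R := j%:R * (T / n.+2%:R).
Let cell (n : nat) (j : nat) : set RR := `[node n j, node n j.+1[%classic.

(** On each cell of a grid the operator is frozen at the left node, where the
    integral vanishes as that of [w] composed with a single functional.  As the
    grid is refined, strong continuity of the semigroup gives pointwise
    convergence, and the norm bound on [w] dominates. *)
Lemma orbit_integral0 l : real_functional l ->
  Rintegrable D (fun s => l (S `|T - s| (w s))) ->
  \int[leb]_(s in D) l (S `|T - s| (w s)) = 0.
Proof.
move=> hl il; have [_ _ [C C0 lC]] := hl.
have M0 := M_ge0 M1.
have h0 n : 0 < T / n.+2%:R by rewrite divr_gt0.
have node0 n j : 0 <= node n j by rewrite mulr_ge0// ltW.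
have nodeS n j : node n j.+1 = node n j + T / n.+2%:R.
  by rewrite /node -[j.+1%:R]natr1 mulrDl mul1r.
have nodeT n j : (j <= n.+2)%N -> node n j <= T.
  by move=> jn; rewrite /node mulrCA ler_piMr ?(ltW T0)// ler_pdivrMr// mul1r ler_nat.
have cellD n j : (j < n.+2)%N -> cell n j `<=` D.
  move=> jn t; rewrite /cell /D/= !in_itv/= => /andP[h1 h2].
  by rewrite (le_trans (node0 n j))//= ltW// (lt_le_trans h2)// nodeT.
have mcell n j : measurable (cell n j) by exact: measurable_itv.
pose lj n j x := l (S `|T - node n j| x).
have hlj n j : real_functional (lj n j).
  by apply: (rf_comp hl M0) => x; exact: SM.
pose F n j : RR -> R := (fun s => lj n j (w s)) \_ (cell n j).
have iF n j : (j < n.+2)%N -> Rintegrable D (F n j).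
  move=> jn; apply: Rintegrable_restrict => //; first exact: cellD.
  apply: integrableS (w_int (hlj n j)) => //; exact: cellD.
pose g n s := \sum_(j < n.+2) F n j s.
have [ig Ig] : (forall n, Rintegrable D (g n)) /\
    (forall n, \int[leb]_(s in D) g n s = 0).
  split=> n; pose F' (j : 'I_n.+2) := F n j.
    by have [] := @Rintegrable_sum _ _ (index_enum 'I_n.+2) F' D mD (fun j => iF n j (ltn_ord j)).
  have [_ ->] := @Rintegrable_sum _ _ (index_enum 'I_n.+2) F' D mD (fun j => iF n j (ltn_ord j)).
  rewrite big1// => j _; rewrite /F' Rintegral_restrict; last exact: cellD.
  apply: w0 => //.
  - by rewrite nodeS ltrDl.
  - by rewrite nodeT.
  - rewrite nodeS addrAC subrr add0r ltr_pdivrMr// ltr_pMr//.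
    by rewrite (ltr_nat _ 1).
have gE n s k : (k < n.+2)%N -> node n k <= s < node n k.+1 ->
    g n s = l (S `|T - node n k| (w s)).
  move=> kn sk; rewrite /g (bigD1 (Ordinal kn))//= big1 ?addr0.
    by rewrite /F patchE mem_set//= /cell/= in_itv.
  move=> j jk; rewrite /F patchE memNset// /cell/= in_itv/= => sj.
  have nlt a b : node n a < node n b -> (a < b)%N by rewrite ltr_pM2r// ltr_nat.
  case/andP: sk => s1 s2; case/andP: sj => s3 s4.
  have := nlt _ _ (le_lt_trans s1 s4); have := nlt _ _ (le_lt_trans s3 s2).
  rewrite !ltnS => j1 j2; move/eqP: jk; apply; apply/val_inj/eqP => /=.
  by rewrite eqn_leq j1 j2.
pose k n s := Num.truncn (s / (T / n.+2%:R)).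
have kP n s : 0 <= s < T -> (k n s < n.+2)%N /\ node n (k n s) <= s < node n (k n s).+1.
  move=> /andP[s0 sT]; have q0 : 0 <= s / (T / n.+2%:R) by rewrite divr_ge0// ltW.
  split.
    rewrite -(ltr_nat R) (le_lt_trans _ (_ : s / (T / n.+2%:R) < _))//.
      by rewrite truncn_le.
    by rewrite ltr_pdivrMr// mulrC divfK// gt_eqF.
  by rewrite /node -ler_pdivlMr// -ltr_pdivrMr//; exact: truncn_itv.
have gC n s : D s -> `|g n s| <= C * M * G s.
  rewrite {1}/D/= in_itv/= => /andP[s0]; rewrite le_eqVlt => /predU1P[->|sT].
    rewrite /g big1; last first.
      move=> j _; rewrite /F patchE memNset// /cell/= in_itv/= => /andP[_].
      by apply/negP; rewrite -leNgt nodeT.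
    rewrite normr0 !mulr_ge0// (le_trans (rnorm_ge0 (w T)))// wG//.
    by rewrite /D/= in_itv/= lexx ltW.
  have [kn kk] := kP n s (introT andP (conj s0 sT)).
  rewrite (gE _ _ _ kn kk) (le_trans (lC _))// -mulrA ler_wpM2l//.
  rewrite (le_trans (SM _ _))// ler_wpM2l// wG//.
  by rewrite /D/= in_itv/= s0 ltW.
have gcv s : D s -> ~ [set T] s -> g n s @[n --> \oo] --> l (S `|T - s| (w s)).
  rewrite {1}/D/= in_itv/= => /andP[s0 sT] /eqP neT.
  have {sT neT}sT : s < T by rewrite lt_neqAle neT.
  have ks n := kP n s (introT andP (conj s0 sT)).
  have -> : (fun n => g n s) = (fun n => l (S `|T - node n (k n s)| (w s))).
    by apply/funext => n; have [k1 k2] := ks n; rewrite (gE _ _ _ k1 k2).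
  apply: rf_cvg => //.
  suff node_s : node n (k n s) @[n --> \oo] --> s.
    have cw : continuous (cst (w s) : R -> H) by move=> t; exact: cvg_cst.
    have cs := @continuous_orbit _ _ S M hS M1 SM (cst (w s)) T cw s.
    exact: (cvg_comp _ _ node_s cs).
  apply: (@cvg_dist_le _ _ (fun n => T * n.+1%:R^-1)).
    by rewrite -[X in _ --> X](mulr0 T); apply: cvgMr; exact: cvg_harmonic.
  move=> n; have [_ /andP[k1 k2]] := ks n.
  rewrite ler0_norm ?subr_le0// opprB.
  rewrite lerBlDl (le_trans (ltW k2))// nodeS lerD2l ler_pM2l// lef_pV2 ?posrE//.
  by rewrite ler_nat.
have := @Rdominated_finite _ D g (fun s => l (S `|T - s| (w s)))
  (fun s => C * M * G s) [set T] mD (finite_set1 _)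
  (fun n => Rintegrable_measurable (ig n)) (Rintegrable_measurable il) gcv
  (RintegrableZ (C * M) mD G_int) gC.
rewrite (_ : (fun _ => _) = cst 0); last by apply/funext => n; rewrite Ig.
by move=> hh; exact: (cvg_unique _ hh (cvg_cst _)).
Qed.

End OrbitIntegral.

(** * Fourier coefficients of Sobolev functions *)

Section Orthogonality.
Context {R : realType} {V : normedModType R[i]}.
Local Notation RR := (measurableTypeR R).
Variables (T : R).
Hypothesis T0 : 0 < T.

Lemma freq_eq0 n : (freq T n == 0) = (n == 0).
Proof.
rewrite /freq !mulf_eq0 invr_eq0 (gt_eqF T0) orbF intr_eq0.
by rewrite (gt_eqF (pi_gt0 R)) pnatr_eq0.
Qed.

Lemma wave_T n : wave T n T = 1.
Proof. by have := wave_period T0 n 0; rewrite add0r wave_0. Qed.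

Lemma wave_integral n (y : V) :
  weak_integral `[0, T] (fun t => wave T n t *: y) (if n == 0 then T%:C *: y else 0).
Proof.
have mD : measurable (`[0, T]%classic : set RR) by exact: measurable_itv.
have [->|n0] := eqVneq n 0.
  move=> l hl; apply: (@eq_weak_integral _ _ _ (cst y)) hl => //.
    by move=> t _; rewrite wave0 scale1r.
  move=> {}l hl; split.
    by apply: (Rintegrable_cst (l y)) => //; exact: itv_measure.
  have := @Rintegral_cst _ _ R (@lebesgue_measure R) `[0, T]%classic mD (l y).
  by rewrite leb_itv ?(ltW T0)// => Iy; rewrite rfZ// mulrC.
pose y' := (0 +i* freq T n)^-1 *: y.
have i0 : 0 +i* freq T n != 0.
  by rewrite eq_complex/= freq_eq0 (negbTE n0) andbF.
have := @weak_FTC _ _ (fun t => wave T n t *: y') (fun t => wave T n t *: y) T (ltW T0)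
  (@continuous_waveZ1 _ _ T n y') (@continuous_waveZ1 _ _ T n y).
have -> : wave T n T *: y' - wave T n 0 *: y' = 0.
  by rewrite wave_T wave_0 subrr.
apply=> t _; have := @has_deriv_wave _ _ T n y' t.
by have -> : (0 +i* freq T n) *: (wave T n t *: y') = wave T n t *: y
  by rewrite /y' !scalerA mulrAC mulfV// mul1r.
Qed.

Lemma simple_scale (c : R -> R[i]^o) (s : R -> V) :
  simple_function c -> simple_function s -> simple_function (fun t => c t *: s t).
Proof.
move=> [fc mc] [fs ms]; split.
  apply: (@sub_finite_set _ _ [set (x : R[i]) *: v | x in range c & v in range s]).
    by move=> _ [t _ <-]; exists (c t); [exists t|exists (s t) => //; exists t].
  exact: finite_image2.
move=> v.
rewrite (_ : _ @^-1` _ = \bigcup_(x in range c)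
    (c @^-1` [set x] `&` \bigcup_(u in range s `&` [set u | (x : R[i]) *: u = v]) s @^-1` [set u])).
  apply: (@fin_bigcup_measurable _ RR) => // x _.
  apply: (@measurableI _ RR); first exact: mc.
  apply: (@fin_bigcup_measurable _ RR); first exact: finite_setIl.
  by move=> u _; exact: ms.
apply/seteqP; split => t /=.
  move=> csv; exists (c t); first by exists t.
  by split => //; exists (s t) => //; split => //; exists t.
by move=> [x _ [-> [u [_ <-] ->]]].
Qed.

Lemma strongly_measurable_waveZ n (f : R -> V) :
  strongly_measurable `[0, T] f -> strongly_measurable `[0, T] (fun t => wave T n t *: f t).
Proof.
move=> [s [ss sf]].
have [c [cs cf]] := @continuous_strongly_measurable _ _ (wave T n : R -> R[i]^o) T (@continuous_wave _ T n).
exists (fun k t => c k t *: s k t); split; first by move=> k; exact: simple_scale.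
by move=> t Dt; apply: cvgZ; [exact: cf|exact: sf].
Qed.

End Orthogonality.

Section L2Functions.
Context {R : realType} {V : normedModType R[i]}.
Local Notation RR := (measurableTypeR R).
Variables (T : R).
Hypothesis T0 : 0 < T.
Let D : set RR := `[0, T]%classic.
Let mD : measurable D. Proof. exact: measurable_itv. Qed.

Lemma strongly_measurable_sub (E : set RR) (f : R -> V) :
  strongly_measurable setT f -> strongly_measurable E f.
Proof. by move=> [s [ss sf]]; exists s; split => // t _; exact: sf. Qed.

Lemma L2_periodic_integrable (g : R -> V) : L2_periodic T g ->
  Rintegrable D (fun t => rnorm (g t)) /\
  exists2 N : R, 0 <= N & L2norm T g = N%:E /\
    \int[leb]_(t in D) rnorm (g t) <= Num.sqrt T * N.
Proof.
move=> [_ gm goo].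
have gmD : strongly_measurable D g by exact: strongly_measurable_sub gm.
have mg : measurable_fun D (fun t => rnorm (g t)) by exact: measurable_rnorm.
have I2 : Rintegrable D (fun t => rnorm (g t) ^+ 2).
  apply/integrableP; split.
    by apply/measurable_EFinP; apply: measurable_funX.
  have : (\int[leb]_(t in D) (rnorm (g t) ^+ 2)%:E < +oo)%E.
    by apply: (@lty_poweRy _ _ 2^-1); rewrite ?invr_eq0.
  congr (_ < _)%E; apply: eq_integral => t _ /=.
  by rewrite ger0_norm// sqr_ge0.
have I1 : Rintegrable D (fun t => rnorm (g t)).
  apply: (@Rintegrable_le _ _ _ (fun t => 1 + rnorm (g t) ^+ 2)) => //.
    apply: RintegrableD => //; apply: (Rintegrable_cst 1) => //; exact: itv_measure.
  move=> t _; rewrite ger0_norm ?rnorm_ge0//.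
  have := sqr_ge0 (rnorm (g t) - 1); have := rnorm_ge0 (g t); rewrite !expr2; lra.
split => //.
set I := \int[leb]_(t in D) (rnorm (g t) ^+ 2).
have I0 : 0 <= I by apply: Rintegral_ge0 => t _; rewrite sqr_ge0.
exists (Num.sqrt I); first exact: sqrtr_ge0.
split.
  rewrite /L2norm (_ : (\int[_]_(_ in _) _)%E = I%:E).
    by rewrite poweR_EFin powR12_sqrt.
  by rewrite /I /Rintegral fineK//; exact: integrable_fin_num I2.
(* The Cauchy-Schwarz inequality, from the nonnegative integral of the square
   of the deviation of the norm from its mean. *)
set J := \int[leb]_(t in D) rnorm (g t).
have J0 : 0 <= J by apply: Rintegral_ge0 => t _; exact: rnorm_ge0.
rewrite -sqrtrM ?(ltW T0)// -[leLHS]ger0_norm// -sqrtr_sqr ler_wsqrtr//.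
pose c := J / T.
have Ic : Rintegrable D (cst (c ^+ 2)).
  by apply: Rintegrable_cst => //; exact: itv_measure.
have : 0 <= \int[leb]_(t in D) ((rnorm (g t) ^+ 2 - 2 * c * rnorm (g t)) + c ^+ 2).
  apply: Rintegral_ge0 => t _.
  by have := sqr_ge0 (rnorm (g t) - c); rewrite !expr2; lra.
rewrite RintegralD//; last first.
  by apply: RintegrableB => //; exact: RintegrableZ.
rewrite RintegralB//; last exact: RintegrableZ.
rewrite RintegralZl// -/I -/J.
have -> : \int[leb]_(t in D) (c ^+ 2) = c ^+ 2 * T.
  have := @Rintegral_cst _ _ R (@lebesgue_measure R) D mD (c ^+ 2).
  by rewrite leb_itv ?(ltW T0).
rewrite (_ : I - 2 * c * J + c ^+ 2 * T = I - J ^+ 2 / T); last first.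
  by rewrite /c; field; rewrite gt_eqF.
by rewrite subr_ge0 ler_pdivrMr// mulrC.
Qed.

End L2Functions.

Section EnumInt.
Context {R : realType}.

(** The order 0, -1, 1, -2, 2 and so on, which turns Fourier series into sums
    over natural numbers with |zint k| comparable to k / 2. *)
Definition zint (k : nat) : int := if odd k then Negz k./2 else Posz k./2.
Definition zidx (n : int) : nat :=
  match n with Posz j => j.*2 | Negz j => j.*2.+1 end.

Lemma zidxK n : zint (zidx n) = n.
Proof. by case: n => j; rewrite /zint /= ?odd_double ?doubleK//= uphalf_double. Qed.

Lemma zintK k : zidx (zint k) = k.
Proof.
rewrite /zint; have := odd_double_half k.
by case: (odd k) => /=; rewrite ?add1n ?add0n.
Qed.

Lemma zint_ge k : k.+1%:R <= 2 * (1 + `|(zint k)%:~R|) :> R.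
Proof.
rewrite -[in leLHS](zintK k); case: (zint k) => j /=.
  rewrite ger0_norm// -[j.*2.+1%:R]natr1 -muln2 natrM; have := ler0n R j; lra.
rewrite NegzE mulrNz normrN ger0_norm// -[j.*2.+2%:R]natr1 -[j.*2.+1%:R]natr1 -muln2 natrM.
by rewrite -[j.+1%:~R]natr1; have := ler0n R j; lra.
Qed.

Lemma freq_zint_ge (T : R) : 0 < T ->
  exists2 c : R, 0 < c & forall k, c * k.+1%:R <= 1 + `|freq T (zint k)|.
Proof.
move=> T0; set f := 2 * pi / T.
have f0 : 0 < f by rewrite divr_gt0// mulr_gt0// pi_gt0.
exists (Num.min 1 f / 2); first by rewrite divr_gt0// lt_min ltr01.
move=> k; have -> : freq T (zint k) = f * (zint k)%:~R by rewrite /freq /f; field; rewrite gt_eqF.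
rewrite normrM (gtr0_norm f0).
have m1 : Num.min 1 f <= 1 by rewrite ge_min lexx.
have mf : Num.min 1 f <= f by rewrite ge_min lexx orbT.
have m0 : 0 <= Num.min 1 f by rewrite le_min ler01 ltW.
have := ler_wpM2l m0 (zint_ge k).
have := ler_wpM2r (normr_ge0 ((zint k)%:~R : R)) mf.
by move: (Num.min 1 f) m1 mf m0 => m m1 mf m0; lra.
Qed.

End EnumInt.

Section Coefficients.
Context {R : realType} {H : completeNormedModType R[i]}.
Local Notation RR := (measurableTypeR R).
Hypothesis Hnorming : @norming R H.
Variables (T : R).
Hypothesis T0 : 0 < T.
Let D : set RR := `[0, T]%classic.
Let mD : measurable D. Proof. exact: measurable_itv. Qed.

Lemma smooth_periodic_wave n :
  smooth_periodic T (fun t => wave T n t *: (1 : R[i]^o)).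
Proof.
split; first by move=> t; rewrite wave_period.
exists (fun k t => wave T n t *: ((0 +i* freq T n) ^+ k : R[i]^o)).
split; first by apply/funext => t; rewrite expr0.
move=> k t; have := @has_deriv_wave _ _ T n ((0 +i* freq T n) ^+ k : R[i]^o) t.
set a := _ *: (_ *: _); set b := (X in _ -> _ --> X).
suff -> : a = b by [].
by rewrite /a /b exprS scalerA mulrC -scalerA.
Qed.

(** The wave is itself a test function for the weak derivative. *)
Lemma weak_deriv_coef (f g : R -> H) m F : weak_deriv T f g ->
  weak_integral D (fun t => wave T m t *: f t) F ->
  weak_integral D (fun t => wave T m t *: g t) (- (0 +i* freq T m) *: F).
Proof.
move=> fg fF.
have [v [/is_bochner_integral_weak + /is_bochner_integral_weak]] :=
  fg _ _ (smooth_periodic_wave m) (@has_deriv_wave _ _ T m (1 : R[i]^o)).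
move=> /(_ mD (itv_measure T)) fv /(_ mD (itv_measure T)) gv.
have w1 t : wave T m t *: (1 : R[i]^o) = wave T m t := mulr1 _.
have vE : v = (0 +i* freq T m) *: F.
  apply: (weak_integral_unique Hnorming _ (weak_integralZ (0 +i* freq T m) mD fF)).
  apply: eq_weak_integral fv => // t _.
  by rewrite w1 scalerA; exact: erefl.
rewrite scaleNr -vE; apply: eq_weak_integral gv => // t _.
by rewrite w1.
Qed.

Lemma sobolev_coef q (f : R -> H) g m F : sobolev_derivs q T f g ->
  weak_integral D (fun t => wave T m t *: f t) F -> forall k, (k <= q)%N ->
  weak_integral D (fun t => wave T m t *: g k t) ((- (0 +i* freq T m)) ^+ k *: F).
Proof.
move=> [g0 _ gd] fF; elim=> [_|k IH kq]; first by rewrite expr0 scale1r g0.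
rewrite exprS -scalerA; apply: weak_deriv_coef; first exact: gd.
exact/IH/ltnW.
Qed.

Lemma coef_exists (f : R -> H) m : L2_periodic T f ->
  exists F, weak_integral D (fun t => wave T m t *: f t) F.
Proof.
move=> fL; have [fi _] := L2_periodic_integrable T0 fL.
have [_ fm _] := fL; have {}fm : strongly_measurable D f by exact: strongly_measurable_sub fm.
have [|F hF] := is_bochner_integral_exists Hnorming mD (itv_measure T)
  (strongly_measurable_waveZ m fm).
  by apply: eq_Rintegrable fi => // t _; rewrite rnormZc cabs_wave mul1r.
by exists F; apply: is_bochner_integral_weak => //; exact: itv_measure.
Qed.

Lemma expr1D_le (x : R) q : 0 <= x -> (1 + x) ^+ q <= 2 ^+ q * (1 + x ^+ q).
Proof.
move=> x0; have xq : 0 <= x ^+ q by rewrite exprn_ge0.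
have [x1|x1] := leP x 1.
  apply: (@le_trans _ _ (2 ^+ q)); last by rewrite ler_peMr ?exprn_ge0// lerDl.
  by rewrite lerXn2r ?nnegrE//; lra.
apply: (@le_trans _ _ ((2 * x) ^+ q)); first by rewrite lerXn2r ?nnegrE//; lra.
by rewrite exprMn ler_wpM2l ?exprn_ge0// lerDr.
Qed.

(** The extreme derivatives suffice: the bounds on F and on |omega|^q |F| from
    the derivatives of order 0 and q combine through [expr1D_le]. *)
Lemma sobolev_coef_le q (f : R -> H) g m F E : sobolev_derivs q T f g ->
  weak_integral D (fun t => wave T m t *: f t) F ->
  \int[leb]_(t in D) rnorm (g 0%N t) <= E -> \int[leb]_(t in D) rnorm (g q t) <= E ->
  (1 + `|freq T m|) ^+ q * rnorm F <= 2 ^+ q * (2 * E).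
Proof.
move=> fg fF E0 Eq; have [g0 gL _] := fg.
have nk k : (k <= q)%N -> `|freq T m| ^+ k * rnorm F <= \int[leb]_(t in D) rnorm (g k t).
  move=> kq; have [gi _] := L2_periodic_integrable T0 (gL k kq).
  have := weak_integral_le Hnorming mD (sobolev_coef fg fF kq) gi.
  rewrite rnormZc cabsX cabsN cabs_i; apply => t _.
  by rewrite rnormZc cabs_wave mul1r.
apply: (le_trans (ler_wpM2r (rnorm_ge0 F) (expr1D_le q (normr_ge0 (freq T m))))).
rewrite -mulrA ler_wpM2l ?exprn_ge0// mulrDl mul1r.
have := nk 0%N (leq0n q); have := nk q (leqnn q); rewrite expr0 mul1r; lra.
Qed.

End Coefficients.

(** * Periodic solutions when the resolvents grow polynomially *)

Section PeriodicSolutions.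
Context {R : realType} {H : completeNormedModType R[i]}.
Local Notation RR := (measurableTypeR R).
Hypothesis Hnorming : @norming R H.
Variables (S : R -> {linear H -> H}) (M : R).
Hypothesis hS : C0_semigroup S.
Hypothesis M1 : 1 <= M.
Hypothesis SM : forall t x, 0 <= t -> rnorm (S t x) <= M * rnorm x.
Hypothesis S_stable : strongly_stable S.
Variables (DA : set H) (A : H -> H).
Hypothesis A_gen : generates DA A S.
Variables (T : R) (T0 : 0 < T).
Variable B : int -> {linear H -> H}.
Hypothesis BE : forall n y, DA (B n y) /\ (0 +i* freq T n) *: B n y - A (B n y) = y.
Variables (p : nat) (C : R).
Hypothesis C1 : 1 <= C.
Hypothesis BC : forall n y, rnorm (B n y) <= C * (1 + `|freq T n|) ^+ p * rnorm y.

Let M0 : 0 <= M. Proof. exact: M_ge0 M1. Qed.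
Let D : set RR := `[0, T]%classic.
Let mD : measurable D. Proof. exact: measurable_itv. Qed.

(** The orbit of a fixed point of [S T] returns to it at all multiples of [T],
    while strong stability makes it tend to 0. *)
Lemma stable_fixed_point x : S T x = x -> x = 0.
Proof.
move=> Sx; have Sn n : S (n%:R * T) x = x.
  elim: n => [|n IH]; first by rewrite mul0r (semi0 hS).
  rewrite -natr1 mulrDl mul1r (semiD hS) ?mulr_ge0 ?(ltW T0)//.
  by rewrite Sx.
apply: rnorm_eq0; apply/eqP; rewrite eq_le rnorm_ge0 andbT.
apply/ler_addgt0Pr => e e0; rewrite add0r.
have /cvg_rnormP/(_ _ e0)[t [t0 ht]] := S_stable x.
have := ht ((Num.truncn (t / T)).+1%:R * T); rewrite Sn subr0 => h.
by apply/ltW/h; rewrite -ltr_pdivrMr// truncnS_gt.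
Qed.

(** Summable bounds are produced in the telescoping form that [rnorm_series]
    expects: 1/k^2 is at most 2/k - 2/(k + 1). *)
Lemma inv_sqr_telescope (c X Y : R) k : 0 < c -> c * k.+1%:R <= X -> 0 <= Y ->
  forall Z, X ^+ 2 * Z <= Y -> 0 <= Z ->
  Z <= 2 * Y / c ^+ 2 / k.+1%:R - 2 * Y / c ^+ 2 / k.+2%:R.
Proof.
move=> c0 cX Y0 Z XZ Z0.
have k1 : 0 < k.+1%:R :> R by rewrite ltr0n.
have k2 : 0 < k.+2%:R :> R by rewrite ltr0n.
have ck : 0 < c * k.+1%:R by rewrite mulr_gt0.
have h1 : (c * k.+1%:R) ^+ 2 * Z <= Y.
  apply: le_trans XZ; rewrite ler_wpM2r// lerXn2r ?nnegrE ?(ltW ck)//.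
  exact: le_trans (ltW ck) cX.
have -> : 2 * Y / c ^+ 2 / k.+1%:R - 2 * Y / c ^+ 2 / k.+2%:R =
    2 * Y / (c ^+ 2 * k.+1%:R * k.+2%:R).
  have -> : k.+2%:R = k.+1%:R + 1 :> R by rewrite -natr1.
  by field; rewrite !gt_eqF//; rewrite natr1.
rewrite ler_pdivlMr ?mulr_gt0 ?exprn_gt0//.
have k12 : k.+2%:R <= 2 * k.+1%:R :> R.
  by rewrite -[k.+2%:R]natr1 -[k.+1%:R]natr1; have := ler0n R k; lra.
have q0 : 0 <= Z * (c ^+ 2 * k.+1%:R) by apply: mulr_ge0 => //; apply: mulr_ge0; [exact/exprn_ge0/ltW|exact: ltW].
have := ler_wpM2l q0 k12; move: h1; rewrite !exprMn !expr2; lra.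
Qed.

(** With [Fs] the Fourier series of [f] and [Z] the sum of the resolvents
    applied to its terms, f - Fs has no Fourier coefficients, so over one period
    [f] acts like [Fs], that is, by Z - S(T) Z.  A periodic solution therefore
    starts at [Z].  Two of the p + 2 derivatives pay for summability, the other
    [p] for the growth of the resolvents. *)
Lemma periodic_solution_le : exists K : R, 0 < K /\
  forall (f : R -> H) g (u : R -> H) (E : R), sobolev_derivs p.+2 T f g ->
    \int[leb]_(t in D) rnorm (g 0%N t) <= E ->
    \int[leb]_(t in D) rnorm (g p.+2 t) <= E ->
    periodic_mild_solution S T f u -> forall t, 0 <= t <= T -> rnorm (u t) <= K * E.
Proof.
have [c c0 cz] := freq_zint_ge T0.
have C0 : 0 < C := lt_le_trans ltr01 C1.
pose K1 := T^-1 * (2 ^+ p.+2 * 2) * C.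
have K10 : 0 <= K1.
  apply/mulr_ge0/ltW/C0; apply: mulr_ge0; first by rewrite invr_ge0 ltW.
  by rewrite mulr_ge0// exprn_ge0.
pose K2 := 2 * K1 / c ^+ 2.
have K20 : 0 <= K2 by rewrite /K2 divr_ge0 ?exprn_ge0 ?(ltW c0)// mulr_ge0.
exists (M * K2 + M + 1); split; first by rewrite ltr_wpDl// addr_ge0// mulr_ge0.
move=> f g u E fg E0 Eq [/mild_solution_weak[u0 uE] uT].
have [g0 gL gd] := fg.
have fL : L2_periodic T f by rewrite -g0; exact: gL.
have [fi _] := L2_periodic_integrable T0 fL.
have En : 0 <= E.
  by apply: le_trans E0; apply: Rintegral_ge0 => t _; exact: rnorm_ge0.
(* [F n] is the coefficient of index [n], up to the factor [T^-1]; it is obtained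
   by integrating against the conjugate wave. *)
have /choice[F hF] : forall n, exists F, weak_integral D (fun t => wave T (- n) t *: f t) F.
  by move=> n; exact: coef_exists.
pose a k := T^-1%:C *: F (zint k).
have aE k : (1 + `|freq T (zint k)|) ^+ p.+2 * rnorm (a k) <= K1 / C * E.
  have := sobolev_coef_le Hnorming T0 fg (hF (zint k)) E0 Eq.
  have -> : `|freq T (- zint k)| = `|freq T (zint k)|.
    by rewrite /freq mulrNz mulrN mulNr normrN.
  have Ti : 0 <= T^-1 by rewrite invr_ge0 ltW.
  rewrite /a rnormZr (ger0_norm Ti) => h.
  have := ler_wpM2l Ti h; rewrite /K1 mulfK; last by rewrite gt_eqF.
  by lra.
have X1 k : 1 <= (1 + `|freq T (zint k)|) ^+ p by rewrite exprn_ege1// lerDl.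
have KC : K1 / C <= K1 by rewrite ler_pdivrMr// ler_peMr.
pose b k : R := K2 * E / k.+1%:R.
have b0 k : 0 <= b k by rewrite /b divr_ge0// mulr_ge0.
have bcv : b @ \oo --> 0.
  rewrite -[X in _ --> X](mulr0 (K2 * E)); apply: cvgMr; exact: cvg_harmonic.
have bE k : b k - b k.+1 = 2 * (K1 * E) / c ^+ 2 / k.+1%:R - 2 * (K1 * E) / c ^+ 2 / k.+2%:R.
  have e : K2 * E = 2 * (K1 * E) / c ^+ 2 by rewrite /K2; ring.
  by rewrite /b e.
have K1E : 0 <= K1 * E by rewrite mulr_ge0.
have ab k : rnorm (a k) <= b k - b k.+1.
  rewrite bE; apply: (inv_sqr_telescope c0 (cz k) K1E _ (rnorm_ge0 _)).
  have r0 := rnorm_ge0 (a k); have := aE k; rewrite -[p.+2]addn2 exprD mulrAC => h.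
  apply: (le_trans _ (le_trans h (ler_wpM2r En KC))).
  rewrite [leRHS]mulrAC -[leRHS]mulrA -[leLHS]mul1r; apply: ler_wpM2r (X1 k).
  by rewrite mulr_ge0// exprn_ge0// addr_ge0.
have Bab k : rnorm (B (zint k) (a k)) <= b k - b k.+1.
  rewrite bE; apply: (inv_sqr_telescope c0 (cz k) K1E _ (rnorm_ge0 _)).
  have X20 : 0 <= (1 + `|freq T (zint k)|) ^+ 2 by rewrite exprn_ge0// addr_ge0.
  apply: (le_trans (ler_wpM2l X20 (BC _ _))).
  have Cp : 0 <= C := ltW C0.
  have := ler_wpM2l Cp (aE k); rewrite -[p.+2]addn2 exprD.
  have -> : C * (K1 / C * E) = K1 * E by field; rewrite gt_eqF.
  by move: ((1 + _) ^+ 2) ((1 + _) ^+ p) (rnorm (a k)) => x y z; lra.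
have wab t k : rnorm (wave T (zint k) t *: a k) <= b k - b k.+1.
  by rewrite rnormZc cabs_wave mul1r.
have /choice[Fs FsE] : forall t, exists l : H, forall n,
    rnorm (l - \sum_(k < n) wave T (zint k) t *: a k) <= b n.
  by move=> t; exact: (@rnorm_series _ _ (fun k => wave T (zint k) t *: a k)).
have [Z ZE] := @rnorm_series _ _ (fun k => B (zint k) (a k)) b bcv b0 Bab.
(* Orthogonality leaves a single term of the series. *)
have Fs_coef n : weak_integral D (fun t => wave T (- n) t *: Fs t) (F n).
  pose v k : H := if zint k == n then F n else 0.
  have vk k : weak_integral D (fun t => wave T (- n) t *: (wave T (zint k) t *: a k)) (v k).
    have := wave_integral T0 (- n + zint k) (a k).
    rewrite addrC subr_eq0 /v; case: eqP => [zn|_].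
      rewrite /a scalerA -rmorphM/= divff ?gt_eqF// scale1r zn.
      by apply: eq_weak_integral => // t _; rewrite [RHS]scalerA waveM// [- n + _]addrC.
    by apply: eq_weak_integral => // t _; rewrite [RHS]scalerA waveM// [- n + _]addrC.
  apply: (weak_integral_lim mD (itv_measure T)
      (fun N => weak_integral_sum N mD vk) _ bcv) => [|N t Dt].
    apply: cvg_near_cst; exists (zidx n).+1 => // N /= nN.
    rewrite (bigD1 (Ordinal nN))//= big1 ?addr0 ?/v ?zidxK ?eqxx// => k kn.
    case: eqP => // zk; case/eqP: kn; apply/val_inj => /=.
    by rewrite -zk zintK.
  have := FsE t N; rewrite -scaler_sumr -scalerBr rnormZc cabs_wave mul1r; exact.
pose w t := f t - Fs t.
have w_coef n : weak_integral D (fun t => wave T n t *: w t) 0.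
  have := weak_integralB mD (hF (- n)) (Fs_coef (- n)); rewrite opprK subrr.
  by apply: eq_weak_integral => // t _; rewrite scalerBr.
(* The response to [Fs] over one period, summed wave by wave. *)
have resp k : weak_integral D (fun s => S `|T - s| (wave T (zint k) s *: a k))
    (B (zint k) (a k) - S T (B (zint k) (a k))).
  have := response_integral hS M1 SM A_gen BE (zint k) (a k) (ltW T0).
  by rewrite /response wave_T// scale1r.
have Fs_resp : weak_integral D (fun s => S `|T - s| (Fs s)) (Z - S T Z).
  have bM : M * b n @[n --> \oo] --> 0.
    by rewrite -[X in _ --> X](mulr0 M); apply: cvgMr.
  apply: (weak_integral_lim mD (itv_measure T)
      (fun N => weak_integral_sum N mD resp) _ bM) => [|N s Ds].
    apply/cvg_rnormP => e e0; have MM : 0 < 1 + M by rewrite ltr_pwDl.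
    have /cvgrPdist_lt/(_ _ (divr_gt0 e0 MM)) := bcv; apply: filterS => N.
    rewrite sub0r normrN ger0_norm// ltr_pdivlMr// => bN.
    rewrite sumrB -linear_sum/= rnormBC.
    have -> : Z - S T Z - (\sum_(i < N) B (zint i) (a i) - S T (\sum_(i < N) B (zint i) (a i)))
      = (Z - \sum_(i < N) B (zint i) (a i)) - S T (Z - \sum_(i < N) B (zint i) (a i)).
      by rewrite (semiB S) !opprD !opprK addrACA.
    apply: le_lt_trans bN; rewrite (le_trans (rnormB_le _ _))// mulrDr mulr1.
    rewrite lerD ?ZE// (le_trans (SM _ (ltW T0)))// mulrC ler_wpM2r// ZE.
  rewrite -linear_sum/= -semiB; apply: (le_trans (SM _ (normr_ge0 _))).
  by rewrite ler_wpM2l// FsE.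
have [v0 hv0 u0E] := uE 0 (lexx 0).
have {hv0}v00 : v0 = 0.
  apply: rnorm_eq0; apply/eqP; rewrite eq_le rnorm_ge0 andbT.
  have := weak_integral_le_cst Hnorming (c := rnorm (f 0)) (lexx 0) hv0.
  rewrite mulr0; apply => s; rewrite -eq_le => /eqP <-.
  by rewrite subrr normr0 (semi0 hS).
have {v0 v00}u0E : u 0 = u0 by rewrite u0E v00 (semi0 hS) addr0.
have [vT hvT uTE] := uE T (ltW T0).
have vTE : vT = Z - S T Z.
  apply/eqP; rewrite -subr_eq0; apply/eqP.
  have dw := weak_integralB mD hvT Fs_resp.
  apply: (weak_integral_unique Hnorming dw) => l hl; split; first exact: (dw l hl).1.
  rewrite rf0//.
  have E1 s : l (S `|T - s| (f s) - S `|T - s| (Fs s)) = l (S `|T - s| (w s)).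
    by rewrite /w (semiB S).
  under eq_Rintegral do rewrite E1.
  apply: (@orbit_integral0 _ _ S M hS M1 SM T w (fun t => rnorm (f t) + (b 0%N + b 0%N))) => //.
  - by move=> a' b' *; exact: (interval_integral0 T0 w_coef).
  - by move=> l' hl'; exact: (zero_coef_integrable w_coef).
  - apply: RintegrableD => //.
    by apply: (Rintegrable_cst (b 0%N + b 0%N)) => //; exact: itv_measure.
  - move=> t _; rewrite /w (le_trans (rnormB_le _ _))// lerD2l.
    have := FsE t 0%N; rewrite big_ord0 subr0 => /le_trans; apply.
    by rewrite lerDl.
  - by apply: eq_Rintegrable (dw l hl).1.
(* u 0 = u T reads u0 - Z = S T (u0 - Z). *)
have u0Z : u0 = Z.
  apply/eqP; rewrite -subr_eq0; apply/eqP/stable_fixed_point.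
  rewrite (semiB S); have := uT 0 (lexx 0); rewrite add0r u0E uTE vTE.
  by move=> h; rewrite -[in RHS]h addrA [RHS]addrAC addrK.
have u0le : rnorm u0 <= K2 * E.
  by have := ZE 0%N; rewrite big_ord0 subr0 u0Z /b divr1.
move=> t /andP[t0 tT]; have [v hv ->] := uE t t0.
have tD : `[0, t]%classic `<=` D.
  by move=> s; rewrite /D/= !in_itv/= => /andP[-> st]; exact: le_trans tT.
have mt : measurable (`[0, t]%classic : set RR) by exact: measurable_itv.
have fit : Rintegrable (`[0, t]%classic : set RR) (fun s => rnorm (f s)).
  exact: integrableS fi.
have vle : rnorm v <= M * E.
  apply: (@le_trans _ _ (\int[leb]_(s in `[0, t]) (M * rnorm (f s)))).
    apply: (weak_integral_le Hnorming mt hv) => [|s _]; last exact: SM.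
    exact: RintegrableZ.
  rewrite RintegralZl// ler_wpM2l//; apply: le_trans E0.
  rewrite -(Rintegral_restrict _ tD) g0; apply: le_Rintegral => //.
    exact: Rintegrable_restrict.
  by move=> s _; rewrite patchE; case: ifP => // _; exact: rnorm_ge0.
rewrite (le_trans (rnormD _ _))//.
have := SM u0 t0; have := ler_wpM2l M0 u0le.
rewrite !mulrDl mul1r => h1 h2.
rewrite -addrA lerD//; first by apply: le_trans h2 _; rewrite -mulrA.
by rewrite ler_wpDr.
Qed.

End PeriodicSolutions.

(** * From derivative loss to resonance *)

Section NormBounds.
Import HBNNSimple.
Context {R : realType} {V : normedModType R[i]}.
Local Notation RR := (measurableTypeR R).

(** The integral of a nonnegative function is a supremum over the simple
    functions below it, each of which is bounded by the constant on [D].  The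
    argument applies to the norm of a mild solution without discussing its
    measurability. *)
Lemma ge0_integral_le_cst (D : set RR) (f : RR -> \bar R) (c : R) :
  measurable D -> (forall t, D t -> 0 <= f t)%E -> (forall t, D t -> f t <= c%:E)%E ->
  0 <= c -> (\int[leb]_(t in D) f t <= c%:E * leb D)%E.
Proof.
move=> mD f0 fc c0; rewrite ge0_integralE//.
apply: ge_ereal_sup => _ [h hf <-].
rewrite -integralT_nnsfun -integral_cst// [leRHS]integral_mkcond.
apply: ge0_le_integral => //.
- by move=> t _; rewrite lee_fin; exact: fun_ge0.
- by apply/measurable_EFinP.
- by apply/(measurable_restrictT _ _).1.
move=> t _; apply: (le_trans (hf t)); rewrite !patchE.
by case: ifPn => // /set_mem; exact: fc.
Qed.

Lemma L2norm_le (T c : R) (u : R -> V) : 0 < T -> 0 <= c ->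
  (forall t, 0 <= t <= T -> rnorm (u t) <= c) ->
  (L2norm T u <= (c * Num.sqrt T)%:E)%E.
Proof.
move=> T0 c0 uc.
have mD : measurable (`[0, T]%classic : set RR) by exact: measurable_itv.
have h : (\int[leb]_(t in `[0%R, T]) ((rnorm (u t)) ^+ 2)%:E <= (c ^+ 2 * T)%:E)%E.
  have := @ge0_integral_le_cst `[0, T]%classic (fun t => ((rnorm (u t)) ^+ 2)%:E) (c ^+ 2) mD.
  have -> : ((c ^+ 2)%:E * lebesgue_measure (`[0%R, T]%classic : set RR) = (c ^+ 2 * T)%:E)%E.
    by rewrite lebesgue_measure_itv/= lte_fin T0 -EFinD subr0 -EFinM.
  apply.
  - by move=> t _; rewrite lee_fin sqr_ge0.
  - move=> t; rewrite /= in_itv/= => /uc ut.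
    by rewrite lee_fin lerXn2r// nnegrE rnorm_ge0.
  - exact: sqr_ge0.
rewrite /L2norm; apply: (@le_trans _ _ (((c ^+ 2 * T)%:E) `^ 2^-1)%E).
  apply: gt0_ler_poweR => //.
  - by rewrite in_itv/= leey andbT integral_ge0// => t _; rewrite lee_fin sqr_ge0.
  - by rewrite in_itv/= leey andbT lee_fin mulr_ge0// ?sqr_ge0// ltW.
rewrite poweR_EFin powR12_sqrt ?mulr_ge0 ?sqr_ge0 ?(ltW T0)//.
by rewrite sqrtrM ?sqr_ge0// sqrtr_sqr ger0_norm.
Qed.

End NormBounds.

Section Loss.
Context {R : realType} {H : completeNormedModType R[i]}.
Hypothesis Hnorming : @norming R H.
Variables (S : R -> {linear H -> H}) (M : R).
Hypothesis hS : C0_semigroup S.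
Hypothesis M1 : 1 <= M.
Hypothesis SM : forall t x, 0 <= t -> rnorm (S t x) <= M * rnorm x.
Hypothesis S_stable : strongly_stable S.
Variables (DA : set H) (A : H -> H).
Hypothesis A_gen : generates DA A S.
Variables (T : R) (T0 : 0 < T).
Variable B : int -> {linear H -> H}.
Hypothesis BE : forall n y, DA (B n y) /\ (0 +i* freq T n) *: B n y - A (B n y) = y.

(** Loss of p + 3 derivatives is a statement about forcings with p + 2 weak
    derivatives, for which [periodic_solution_le] bounds the solution
    uniformly in time. *)
Lemma polynomial_resolvent_no_loss p C : 1 <= C ->
  (forall n y, rnorm (B n y) <= C * (1 + `|freq T n|) ^+ p * rnorm y) ->
  ~ derivative_loss S T p.+3.
Proof.
move=> C1 BC; apply; rewrite [p.+3.-1]/=.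
have [K [K0 hK]] := periodic_solution_le Hnorming hS M1 SM S_stable A_gen T0 BE C1 BC.
have KT : 0 < K * T by rewrite mulr_gt0.
exists (K * T); split => // f u _ hu.
rewrite -lee_pdivrMl//; apply: le_ereal_inf_tmp => _ [g hg <-].
rewrite lee_pdivrMl//.
have [g0 gL _] := hg.
have /choice[N hN] : forall k, exists N : R, (k <= p.+2)%N ->
    [/\ 0 <= N, L2norm T (g k) = N%:E &
      \int[leb]_(t in `[0, T]) rnorm (g k t) <= Num.sqrt T * N].
  move=> k; have [kp|kp] := leqP k p.+2; last by exists 0.
  by have [_ [N N0 [N1 N2]]] := L2_periodic_integrable T0 (gL k kp); exists N.
pose NN := Num.sqrt (\sum_(k < p.+3) N k ^+ 2).
have -> : ((\sum_(k < p.+3) L2norm T (g k) ^+ 2) `^ 2^-1)%E = NN%:E.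
  rewrite (eq_bigr (fun k : 'I_p.+3 => (N k ^+ 2)%:E)); last first.
    by move=> k _; have [|_ -> _] := hN k; [rewrite -ltnS|rewrite -EFin_expe].
  rewrite sumEFin poweR_EFin powR12_sqrt//.
  by apply: sumr_ge0 => k _; exact: sqr_ge0.
have Nle k : (k <= p.+2)%N -> \int[leb]_(t in `[0, T]) rnorm (g k t) <= Num.sqrt T * NN.
  move=> kp; have [Nk0 _ h] := hN k kp; apply: (le_trans h).
  rewrite ler_wpM2l ?sqrtr_ge0// -[leLHS]ger0_norm// -sqrtr_sqr ler_wsqrtr//.
  have kp' : (k < p.+3)%N by [].
  rewrite (bigD1 (Ordinal kp'))//= lerDl; apply: sumr_ge0 => j _; exact: sqr_ge0.
have NN0 : 0 <= NN by exact: sqrtr_ge0.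
have := hK f g u _ hg (Nle 0%N (leq0n _)) (Nle p.+2 (leqnn _)) hu.
move=> /(L2norm_le T0 _)/le_trans; apply.
  by rewrite !mulr_ge0// ?sqrtr_ge0// ltW.
rewrite -EFinM lee_fin le_eqVlt; apply/orP; left; apply/eqP.
by rewrite mulrA mulrAC -[RHS]mulrA -{3}(sqr_sqrtr (ltW T0)); ring.
Qed.

Lemma infinite_loss_resolvent : infinite_derivative_loss S T ->
  forall (p : nat) (C : R), exists n y,
    C * (1 + `|freq T n|) ^+ p * rnorm y < rnorm (B n y).
Proof.
move=> A_loss p C; apply: contrapT => no.
apply: (@polynomial_resolvent_no_loss p (Num.max 1 C)).
- by rewrite le_max lexx.
- move=> n y; rewrite leNgt; apply/negP => h; apply: no; exists n, y.
  apply: le_lt_trans h; rewrite ler_wpM2r ?rnorm_ge0// ler_wpM2r//.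
  by rewrite le_max lexx orbT.
- exact: A_loss.
Qed.

End Loss.

Section ResonanceCriterion.
Context {R : realType} {H : completeNormedModType R[i]}.
Local Notation RR := (measurableTypeR R).
Hypothesis Hnorming : @norming R H.
Variables (S : R -> {linear H -> H}) (M : R).
Hypothesis hS : C0_semigroup S.
Hypothesis M1 : 1 <= M.
Hypothesis SM : forall t x, 0 <= t -> rnorm (S t x) <= M * rnorm x.

Lemma periodic_bounded (T K : R) (u : R -> H) : 0 < T ->
  (forall t, 0 <= t -> u (t + T) = u t) ->
  (forall t, 0 <= t <= T -> rnorm (u t) <= K) -> forall t, 0 <= t -> rnorm (u t) <= K.
Proof.
move=> T0 uT uK t t0.
have un n r : 0 <= r -> u (r + n%:R * T) = u r.
  move=> r0; elim: n => [|n IH]; first by rewrite mul0r addr0.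
  by rewrite -natr1 mulrDl mul1r addrA uT// addr_ge0// mulr_ge0// ltW.
pose n := Num.truncn (t / T).
have /andP[n1 n2] := truncn_itv (divr_ge0 t0 (ltW T0)).
rewrite -/n ler_pdivlMr// in n1; rewrite -/n ltr_pdivrMr// -natr1 mulrDl mul1r in n2.
rewrite -(subrK (n%:R * T) t) un ?subr_ge0//; apply: uK.
by rewrite subr_ge0 n1/= lerBlDl ltW.
Qed.

(** Mild solutions with different initial values differ by an orbit of [S],
    which is bounded.  So if the response from 0 is unbounded then all mild
    solutions are, but a periodic one is bounded by its values on one period. *)
Lemma unbounded_response_resonant (T Kf : R) (f : R -> H) : 0 < T -> continuous f ->
  (forall t, rnorm (f t) <= Kf) ->
  (forall K : R, exists2 t, 0 <= t & forall v,
     weak_integral `[0, t] (fun s => S `|t - s| (f s)) v -> K <= rnorm v) ->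
  statically_resonant S T f /\ secularly_resonant S f.
Proof.
move=> T0 cf fK unb; have M0 := M_ge0 M1.
have Kf0 : 0 <= Kf by exact: le_trans (rnorm_ge0 (f 0)) (fK 0).
split.
  move=> [u [/mild_solution_weak[u0 hu] uT]].
  pose K := M * rnorm u0 + M * Kf * T.
  have uK : forall t, 0 <= t -> rnorm (u t) <= K.
    apply: (periodic_bounded T0 uT) => t /andP[t0 tT]; have [v hv ->] := hu t t0.
    rewrite (le_trans (rnormD _ _))// lerD ?SM//.
    apply: (@le_trans _ _ (M * Kf * t)); last by rewrite ler_wpM2l// mulr_ge0.
    apply: (weak_integral_le_cst Hnorming t0 hv) => s _.
    by rewrite (le_trans (SM _ _))// ler_wpM2l.
  have [t t0 ht] := unb (K + M * rnorm u0 + 1).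
  have [v hv uE] := hu t t0; have := ht v hv.
  have : rnorm v <= K + M * rnorm u0.
    rewrite (_ : v = u t - S t u0); last by rewrite uE addrC addKr.
    by rewrite (le_trans (rnormB_le _ _))// lerD ?uK ?SM.
  by move=> /(le_trans _)/[apply]; rewrite gerDl ler10.
have [u [hu uv]] := zero_mild_solution Hnorming hS M1 SM cf; exists u; split => //.
apply/eqyP => K _; have [t t0 ht] := unb K.
apply: (@le_trans _ _ (rnorm (u t))%:E); first by rewrite lee_fin; exact/ht/uv.
by apply: ereal_sup_ubound; exists t.
Qed.

End ResonanceCriterion.

Theorem theorem2p13 (R : realType) (H : completeNormedModType R[i])
    (dot : {dot H for Num.conj})
    (norm_dot : forall x : H, `|x| ^+ 2 = dot x x)
    (DA : set H) (A : H -> H) (S : R -> {linear H -> H}) (T : R)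
    (S_semigroup : C0_semigroup S) (A_gen : generates DA A S)
    (S_bounded : uniformly_bounded S) (S_stable : strongly_stable S)
    (T_gt0 : 0 < T)
    (omega_resolvent : forall n : int,
       resolvent_set DA A (0 +i* (2 * pi * n%:~R / T)))
    (A_loss : infinite_derivative_loss S T) :
  exists f : R -> H,
    [/\ smooth_periodic T f,
        statically_resonant S T f
      & secularly_resonant S f].
Proof.
have Hnorming := hilbert_norming norm_dot.
have [M' SM'] := S_bounded.
pose M := Num.max 1 M'.
have M1 : 1 <= M by rewrite le_max lexx.
have SM t x : 0 <= t -> rnorm (S t x) <= M * rnorm x.
  move=> t0; apply: (le_trans (SM' t x t0)).
  by rewrite ler_wpM2r ?rnorm_ge0// le_max lexx orbT.
have /choice[B hB] : forall n : int, exists B : {linear H -> H},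
    forall y, DA (B y) /\ (0 +i* freq T n) *: B y - A (B y) = y.
  by move=> n; have [B [_ BE _]] := omega_resolvent n; exists B.
have large := infinite_loss_resolvent Hnorming S_semigroup M1 SM S_stable A_gen
  T_gt0 hB A_loss.
have [f [fs fc [Kf fK] funb]] := resonant_forcing Hnorming S_semigroup M1 SM S_stable
  A_gen T_gt0 hB large.
have [fstat fsec] := unbounded_response_resonant Hnorming S_semigroup M1 SM T_gt0
  fc fK funb.
by exists f.
Qed.
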